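(* Let $\Gamma$ be a metric graph, let $D$ be a divisor on $\Gamma$, and let $G=(V,E)$ be a combinatorial graph underlying $\Gamma$ (that is, a model of $\Gamma$) such that $D$ is supported on $V$. For each integer $r\geq 0$, there are finitely many combinatorial subdivisions $H_1,\dots,H_k$ of $G$ and finitely many slope structures $\mathfrak S_1,\dots,\mathfrak S_k$ of width $r$, with $\mathfrak S_j$ defined on the graph $H_j$, such that for every admissible semimodule $M\subset\mathrm{Rat}(D)$ of rank $r$ with underlying slope structure $\mathfrak S$, there is an index $j\in\{1,\dots,k\}$ such that $H_j$ is a combinatorial model of $\Gamma$ on which $\mathfrak S$ is defined and $\mathfrak S=\mathfrak S_j$; that is, for a suitable choice of the positions in $\Gamma$ of the subdivision vertices of $H_j$, $\mathfrak S$ is the slope structure on $\Gamma$ induced by $\mathfrak S_j$.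
   Context: Metric graphs. A metric graph $\Gamma$ is the metric realization of a pair $(G,\ell)$, where $G=(V,E)$ is a finite connected graph with at least one edge and $\ell\colon E\to\mathbb R_{>0}$: each edge $e$ is replaced by a closed interval of length $\ell(e)$, glued according to $G$, with the path metric. $G$ (with $\ell$) is called a model of $\Gamma$; a model is simple if it has no loops and no parallel edges. $\mathrm T_x(\Gamma)$ is the finite set of outgoing unit tangent vectors at $x$, and $d_x=|\mathrm T_x(\Gamma)|$. $\mathrm{Rat}(\Gamma)$ is the set of continuous piecewise affine functions $f\colon\Gamma\to\mathbb R$ with integral slopes; $\mathrm{slope}_\nu(f)$ is the outgoing slope of $f$ along $\nu$. A divisor $D$ is a finite formal integer combination of points of $\Gamma$, $D(x)$ is its coefficient at $x$, $D\ge 0$ (effective) means all coefficients are $\geq 0$. $\mathrm{div}(f)=\sum_x \mathrm{ord}_x(f)(x)$ with $\mathrm{ord}_x(f)=-\sum_{\nu\in \mathrm T_x(\Gamma)}\mathrm{slope}_\nu(f)$. $\mathrm{Rat}(D)=\{f\in\mathrm{Rat}(\Gamma): D+\mathrm{div}(f)\ge 0\}$. A combinatorial subdivision of $G$ is an abstract graph obtained by replacing each edge of $G$ by a path; placing its new vertices in the interiors of the corresponding edges of $\Gamma$, in the prescribed order and at any distinct positions, makes it a model of $\Gamma$. Hypercube rank functions. Put $[r]=\{0,\dots,r\}$. The hypercube $[r]^\delta$ ($\delta\geq 1$) carries the coordinatewise order $\preceq$ and coordinatewise max $\vee$ and min $\wedge$; $\underline e_i$ is the $i$-th unit vector. A rank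 function is a map $\rho\colon[r]^\delta\to\mathbb Z$ such that: (1) $\rho(t\,\underline e_i)=r-t$ for all $i$ and $t\in[r]$; (2) $\underline a\preceq\underline b$ implies $\rho(\underline b)\le\rho(\underline a)$; (3) $\rho(\underline a)+\rho(\underline b)\le\rho(\underline a\vee\underline b)+\rho(\underline a\wedge\underline b)$; (4) $\rho$ takes values in $\{-1,0,\dots,r\}$. A jump of $\rho$ is a point $\underline a$ with $\rho(\underline a)\ge 0$ and $\rho(\underline a+\underline e_i)=\rho(\underline a)-1$ for every $i$ with $\underline a+\underline e_i\in[r]^\delta$. The standard rank function is $\rho(\underline a)=\max\{-1,r-a_1-\dots-a_\delta\}$. Slope structures. A slope structure of width $r$ on a simple graph $H=(V',E')$ is the data of: for every oriented edge $uv$, a set $S^{uv}$ of integers $s_0^{uv}<\dots<s_r^{uv}$ with $s_i^{uv}+s_{r-i}^{vu}=0$; for every $v\in V'$, a rank function $\rho_v$ on $[r]^{d_v}$ ($d_v$ the valence of $v$), whose coordinates are indexed by the oriented edges with tail $v$. A slope structure $\mathfrak S$ of width $r$ on $\Gamma$ is one induced from some simple graph model $H$ of $\Gamma$ (one then says that $\mathfrak S$ is defined on $H$) as follows: for $x\in\Gamma$, $\nu\in \mathrm T_x(\Gamma)$, $S^\nu=\{s_0^\nu<\dots<s_r^\nu\}$ is $S^{uv}$ for the oriented edge $uv$ of $H$ parallel to $\nu$; for $x\in\Gamma\setminus V'$, $\rho_x$ is the standard rank function on $[r]^2$. Two slope structures on $\Gamma$ are equal if all sets $S^\nu$ and rank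 functions $\rho_x$ agree. For $\underline a=(a_\nu)_\nu\in[r]^{\mathrm T_x(\Gamma)}$ put $s_{\underline a}=(s^\nu_{a_\nu})_\nu$, and let $S^x=\{s_{\underline a}:\underline a\text{ a jump of }\rho_x\}$. A function $f\in\mathrm{Rat}(\Gamma)$ is compatible with $\mathfrak S$ if for every $x\in\Gamma$, $\mathrm{slope}_\nu(f)\in S^\nu$ for all $\nu\in\mathrm T_x(\Gamma)$, and $\partial_x(f):=(\mathrm{slope}_\nu(f))_{\nu\in \mathrm T_x(\Gamma)}\in S^x$. If $\partial_x(f)=s_{\underline a}$, write $\rho_x(\partial_x(f)):=\rho_x(\underline a)$. $\mathrm{Rat}(D,\mathfrak S)$ is the set of $f\in\mathrm{Rat}(D)$ compatible with $\mathfrak S$. Admissible semimodules. A semimodule is a subset of $\mathrm{Rat}(\Gamma)$ stable under $(f,g)\mapsto\min(f,g)$ and $f\mapsto f+c$, $c\in\mathbb R$. A semimodule $M\subseteq\mathrm{Rat}(D)$ is admissible of rank $r$, with underlying slope structure $\mathfrak S$, if it is closed for the topology of $\|\cdot\|_\infty$, $\mathfrak S$ is a slope structure of width $r$ on $\Gamma$ with $M\subseteq\mathrm{Rat}(D,\mathfrak S)$, and for every effective divisor $E$ of degree $r$ there is $f\in M$ with $\rho_x(\partial_x(f))\ge E(x)$ for all $x\in\Gamma$ and $D+\mathrm{div}(f)-E\ge 0$. *)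

(* Defs.v *)
From HB Require Import structures.
From mathcomp Require Import all_boot all_order all_algebra.
From mathcomp Require Import finmap.
From mathcomp Require Import all_classical reals.

Set Implicit Arguments.
Unset Strict Implicit.
Unset Printing Implicit Defensive.

Import Order.TTheory GRing.Theory Num.Theory.
Local Open Scope ring_scope.
Local Open Scope classical_set_scope.

(** * Finite graphs, loops and parallel edges allowed *)

(* An edge is given with a reference orientation, from [ends e false] to
   [ends e true]. *)
Record graph := Graph {
  vertex : finType;
  edge : finType;
  ends : edge -> bool -> vertex }.

(* Oriented edges: [(e, false)] is [e] with its reference orientation and
   [(e, true)] is the opposite one. *)
Definition oarc (G : graph) : finType := (edge G * bool)%type.
Definition arc_tail (G : graph) (a : oarc G) : vertex G := ends a.1 a.2.
Definition arc_head (G : graph) (a : oarc G) : vertex G := ends a.1 (~~ a.2).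
Definition opp_arc (G : graph) (a : oarc G) : oarc G := (a.1, ~~ a.2).

Definition adjacent (G : graph) : rel (vertex G) :=
  [rel u v | [exists a : oarc G, (arc_tail a == u) && (arc_head a == v)]].
Definition connected_graph (G : graph) : Prop :=
  forall u v : vertex G, connect (@adjacent G) u v.

Definition simple_graph (G : graph) : Prop :=
  (forall a : oarc G, arc_tail a <> arc_head a) /\
  (forall a b : oarc G, arc_tail a = arc_tail b -> arc_head a = arc_head b -> a.1 = b.1).

Definition out_arcs (G : graph) (v : vertex G) : {set oarc G} :=
  [set a | arc_tail a == v].

(** * Metric graphs *)

Section MetricGraph.
Context {R : realType} {G : graph}.

Definition metric_graph (ell : edge G -> R) : Prop :=
  [/\ connected_graph G, (0 < #|edge G|)%N & forall e, 0 < ell e].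

Context (ell : edge G -> R).

(* The underlying set of the realization of [(G, ell)]: the vertices, and for
   every edge [e] the open interval of parameters [t] with [0 < t < ell e]. *)
Definition is_point (p : vertex G + edge G * R) : bool :=
  match p with
  | inl _ => true
  | inr (e, t) => (0 < t) && (t < ell e)
  end.

Record mpoint := Point { point_val : vertex G + edge G * R;
                        _ : is_point point_val }.
HB.instance Definition _ := [isSub for point_val].
HB.instance Definition _ := [Choice of mpoint by <:].

Definition vert (v : vertex G) : mpoint := @Point (inl v) isT.

(* The point of parameter [t] on the closed edge [e]; parameters outside
   [0, ell e] are sent to the nearest end. *)
Definition pt (e : edge G) (t : R) : mpoint :=
  insubd (vert (ends e (0 < t))) (inr (e, t)).

(* The path metric: the infimum of the lengths of the finite chains of
   segments, each of them contained in one closed edge, that join the points. *)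
Inductive route (x : mpoint) : mpoint -> R -> Prop :=
| route_nil : route x x 0
| route_step (e : edge G) (s t L : R) :
    0 <= s <= ell e -> 0 <= t <= ell e ->
    route x (pt e s) L -> route x (pt e t) (L + `|t - s|).

Definition dist (x y : mpoint) : R := inf [set L | route x y L].

(* Unit tangent vectors at [x] are represented by oriented edges: those with
   tail [v] if [x] is a vertex [v], the two orientations of [e] if [x] lies in
   the interior of [e]. *)
Definition tan_arcs (x : mpoint) : {set oarc G} :=
  match val x with
  | inl v => out_arcs v
  | inr (e, _) => [set a | a.1 == e]
  end.
Definition tangent (x : mpoint) : finType := {a : oarc G | a \in tan_arcs x}.

(* The point at distance [h] from [x] in the direction [nu], for small [h]. *)
Definition arc_pt (a : oarc G) (t : R) : mpoint :=
  pt a.1 (if a.2 then ell a.1 - t else t).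
Definition arc_pos (x : mpoint) (a : oarc G) : R :=
  match val x with
  | inl _ => 0
  | inr (_, t) => if a.2 then ell a.1 - t else t
  end.
Definition advance (x : mpoint) (nu : tangent x) (h : R) : mpoint :=
  arc_pt (val nu) (arc_pos x (val nu) + h).

(** * Rational functions and divisors *)

Definition continuous_fun (f : mpoint -> R) : Prop :=
  forall x (eps : R), 0 < eps -> exists2 delta : R, 0 < delta &
    forall y, dist x y < delta -> `|f y - f x| < eps.

Definition piecewise_affine (f : mpoint -> R) : Prop :=
  forall e : edge G,
  exists (N : nat) (t : nat -> R) (m : nat -> int) (c : nat -> R),
  [/\ t 0%N = 0, t N = ell e,
      forall i, (i < N)%N -> t i < t i.+1 &
      forall i, (i < N)%N -> forall s, t i < s < t i.+1 ->
        f (pt e s) = (m i)%:~R * s + c i].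

Definition Rat : set (mpoint -> R) :=
  [set f | continuous_fun f /\ piecewise_affine f].

Definition has_slope (f : mpoint -> R) (x : mpoint) (nu : tangent x) (m : int) :=
  exists2 delta : R, 0 < delta &
    forall h, 0 < h < delta -> f (advance nu h) = f x + m%:~R * h.

(* For [f] in [Rat] there is exactly one such integer; the default value is
   irrelevant. *)
Definition slope (f : mpoint -> R) (x : mpoint) (nu : tangent x) : int :=
  xget 0 [set m | has_slope f nu m].

Definition ord_at (f : mpoint -> R) (x : mpoint) : int :=
  - \sum_(nu : tangent x) slope f nu.

Definition divisor := {fsfun mpoint -> int with 0}.

Definition effective (D : divisor) : Prop := forall x, 0 <= D x.
Definition degree (D : divisor) : int := \sum_(x <- finsupp D) D x.

Definition RatD (D : divisor) : set (mpoint -> R) :=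
  [set f | Rat f /\ forall x, 0 <= D x + ord_at f x].

End MetricGraph.

Arguments mpoint {R G} ell.
Arguments divisor {R G} ell.

(** * Rank functions on hypercubes *)

(* The coordinates are indexed by a finite type [I]. *)
Definition cube (r : nat) (I : finType) := {ffun I -> 'I_r.+1}.

Section Hypercube.
Context {r : nat} {I : finType}.
Implicit Types (a b : cube r I) (rho : cube r I -> int).

Definition cube_le a b : Prop := forall i, (a i <= b i)%N.
Definition cube_max a b : cube r I := [ffun i => Order.max (a i) (b i)].
Definition cube_min a b : cube r I := [ffun i => Order.min (a i) (b i)].

(* The point [t e_i]. *)
Definition cube_axis (t : 'I_r.+1) (i : I) : cube r I :=
  [ffun j => if j == i then t else ord0].

Definition rank_function rho : Prop :=
  [/\ forall (i : I) (t : 'I_r.+1), rho (cube_axis t i) = r%:Z - t%:Z,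
      forall a b, cube_le a b -> rho b <= rho a,
      forall a b, rho a + rho b <= rho (cube_max a b) + rho (cube_min a b) &
      forall a, -1 <= rho a <= r%:Z].

(* [b = a + e_i] *)
Definition cube_succ a (i : I) b : Prop :=
  forall j, (b j = a j + (j == i) :> nat)%N.

Definition jump rho a : Prop :=
  0 <= rho a /\ forall i b, cube_succ a i b -> rho b = rho a - 1.

Definition standard_rank a : int :=
  Num.max (-1) (r%:Z - (\sum_i (a i : nat))%N%:Z).

End Hypercube.

(** * Slope structures *)

(* The set of slopes of an oriented edge is given by its increasing
   enumeration; [rev_ord i] is [r - i]. *)
Record slope_structure (r : nat) (H : graph) := SlopeStructure {
  gslope : oarc H -> 'I_r.+1 -> int;
  grank : forall v : vertex H, cube r {a : oarc H | a \in out_arcs v} -> int;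
  gsimple : simple_graph H;
  gslope_lt : forall a (i j : 'I_r.+1), (i < j)%N -> gslope a i < gslope a j;
  gslope_opp : forall a i, gslope a i + gslope (opp_arc a) (rev_ord i) = 0;
  grankP : forall v, rank_function (@grank v) }.

(* The sets [S^nu] and the rank functions [rho_x] on a metric graph. *)
Record slope_data (r : nat) (R : realType) (G : graph) (ell : edge G -> R) :=
  SlopeData {
    mslope : forall x : mpoint ell, tangent x -> 'I_r.+1 -> int;
    mrank : forall x : mpoint ell, cube r (tangent x) -> int }.

Section Models.
Context {R : realType} {G H : graph} {ell : edge G -> R} {ell' : edge H -> R}.
Variable phi : mpoint ell' -> mpoint ell.

Definition model : Prop :=
  [/\ metric_graph ell', bijective phi &
      forall x y, dist (phi x) (phi y) = dist x y].

(* [nu] is the image of [nu'] under the differential of [phi]. *)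
Definition parallel (y : mpoint ell') (nu' : tangent y) (nu : tangent (phi y)) :=
  exists2 delta : R, 0 < delta &
    forall h, 0 < h < delta -> phi (advance nu' h) = advance nu h.

Definition induced (r : nat) (s : slope_structure r H) (S : slope_data r ell) :=
  [/\ forall (y : mpoint ell') (nu' : tangent y) (nu : tangent (phi y)),
        parallel nu' nu -> forall i, mslope S nu i = gslope s (val nu') i,
      forall (v : vertex H)
          (a : cube r (tangent (phi (vert ell' v))))
          (b : cube r (tangent (vert ell' v))),
        (forall nu' nu, @parallel (vert ell' v) nu' nu -> a nu = b nu') ->
        mrank S a = grank s b &
      forall x : mpoint ell, (forall v, phi (vert ell' v) <> x) ->
        forall a : cube r (tangent x), mrank S a = standard_rank a].

Definition defined_on (r : nat) (s : slope_structure r H)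
    (S : slope_data r ell) : Prop :=
  model /\ induced s S.

End Models.

Section Admissible.
Context {R : realType} {G : graph} {ell : edge G -> R} {r : nat}.
Implicit Types (S : slope_data r ell) (f : mpoint ell -> R).
Implicit Types (D E : divisor ell) (M : set (mpoint ell -> R)).

Definition is_slope_structure S : Prop :=
  exists (H : graph) (ell' : edge H -> R) (phi : mpoint ell' -> mpoint ell)
    (s : slope_structure r H), defined_on phi s S.

(* [slopes_at S f a] says that the slopes of [f] at [x] are [s_a]; there is at
   most one such [a]. *)
Definition slopes_at S f (x : mpoint ell) (a : cube r (tangent x)) : Prop :=
  forall nu : tangent x, slope f nu = mslope S nu (a nu).

Definition compatible S f : Prop :=
  forall x : mpoint ell,
    (forall nu : tangent x, exists i, slope f nu = mslope S nu i) /\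
    (exists2 a : cube r (tangent x), jump (@mrank _ _ _ _ S x) a
                                   & slopes_at S f a).

Definition RatDS D S : set (mpoint ell -> R) :=
  [set f | RatD D f /\ compatible S f].

Definition semimodule M : Prop :=
  [/\ M `<=` Rat (ell := ell),
      forall f g, M f -> M g -> M (fun x => Num.min (f x) (g x)) &
      forall f (c : R), M f -> M (fun x => f x + c)].

Definition sup_closed M : Prop :=
  forall f, Rat f ->
    (forall eps : R, 0 < eps -> exists2 g, M g & forall x, `|f x - g x| <= eps) ->
    M f.

Definition admissible D M S : Prop :=
  [/\ semimodule M /\ M `<=` RatD D,
      sup_closed M,
      is_slope_structure S,
      M `<=` RatDS D S &
      forall E, effective E -> degree E = r%:Z ->
        exists2 f, M f & forall x,
          (exists2 a : cube r (tangent x), slopes_at S f a & E x <= mrank S a)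
          /\ 0 <= D x + ord_at f x - E x].

End Admissible.

(** * Combinatorial subdivisions *)

Section Subdivision.
Context {G : graph} (n : edge G -> nat).

Definition sub_vertex : finType := (vertex G + {e : edge G & 'I_(n e)})%type.
Definition sub_edge : finType := {e : edge G & 'I_(n e).+1}.

(* The vertices of the path replacing [e], for [k = 0, ..., (n e).+1]. *)
Definition path_vertex (e : edge G) (k : nat) : sub_vertex :=
  if k is k'.+1 then
    if (insub k' : option 'I_(n e)) is Some i
    then inr (existT (fun e => 'I_(n e)) e i)
    else inl (ends e true)
  else inl (ends e false).

(* [G] with every edge [e] replaced by a path with [n e] new vertices. *)
Definition subdivision : graph :=
  @Graph sub_vertex sub_edge
    (fun e b => path_vertex (tag e) (tagged e + b)%N).

Context {R : realType} (ell : edge G -> R) (p : edge G -> nat -> R).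

(* [p e k] is the position in [e] of the vertex [path_vertex e k]. *)
Definition placement : Prop :=
  forall e, [/\ p e 0%N = 0, p e (n e).+1 = ell e &
                forall k, (k <= n e)%N -> p e k < p e k.+1].

Definition sub_length (e : edge subdivision) : R :=
  p (tag e) (tagged e).+1 - p (tag e) (tagged e).

Definition place (y : mpoint sub_length) : mpoint ell :=
  match val y with
  | inl (inl v) => vert ell v
  | inl (inr u) => pt ell (tag u) (p (tag u) (tagged u).+1)
  | inr (e, t) => pt ell (tag e) (p (tag e) (tagged e) + t)
  end.

End Subdivision.

Arguments subdivision {G} n.
Arguments place {G n R} ell p y.

(* Main.v *)
Require Import Defs.
From mathcomp Require Import all_boot all_order all_algebra.
From mathcomp Require Import finmap.
From mathcomp Require Import all_classical reals.
From mathcomp Require Import ring lra zify.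

Set Implicit Arguments.
Unset Strict Implicit.
Unset Printing Implicit Defensive.

Import Order.TTheory GRing.Theory Num.Theory.
Local Open Scope ring_scope.
Local Open Scope classical_set_scope.

(** Along an edge of [G], a slope structure carrying an admissible semimodule is
    a decreasing staircase, and its height is bounded in terms of the graph and
    of [D] only.

    Functions of [RatD D] are concave on edges, since [D] lives on vertices, and
    their slopes are bounded: near a minimum no outgoing slope is very negative,
    the outgoing slopes at a vertex [v] have sum at most [D v], and so bounds
    propagate from a minimal vertex through the connected graph
    ([RatD_slope_bounded]).

    Let [M] be admissible with slope structure [S].  At a point where the rank
    function is standard, a function of rank at least [k] has slope index at
    most [r - k] in both directions.  Apply the rank condition to the divisor
    [(r - i) x1 + i x2], with [x1] before [x2] on an edge: some concave [f] in
    [M] has slope at most the [i]-th one after [x1] and at least the [i]-th one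
    before [x2] ([admissible_two_points]).  Comparing the two by concavity shows
    that the [i]-th slope never increases along the edge ([slopes_mono]), and,
    when [x1] and [x2] are close, that it is a slope of some [f] in [M]
    ([slopes_attained]), hence bounded.  The sum of the slopes therefore drops
    at every break, that is, every point where the slopes change, and it is a
    bounded integer, so that the number of breaks is bounded uniformly in [M].
    At an interior point that is not a break, the same functions [f] show that
    every point of the antidiagonal of the square is a jump of the rank
    function, which forces it to be standard ([rank_standard_of_antidiagonal],
    [not_break_standard]).

    Consequently all the information sits at the vertices and at boundedly many
    other points of each edge.  Adding arbitrary points, every edge can be cut
    into the same number of pieces; one simple subdivision then serves for all
    [M], and it carries finitely many slope structures with bounded slopes
    ([finitely_many_bounded_structures]).

    Both the model on which [S] is given and the one that is built are isometries
    of metric graphs.  They are compared through germs: an isometry maps short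
    unit speed segments to such segments ([isometry_germ]), because small balls
    are stars ([germ_ball]); hence it identifies tangent vectors
    ([tangent_bij]), and the slope structure has a description near each point
    that does not refer to its model ([slope_structure_local]). *)

(** * Induction along a closed interval *)

Section RealInduction.
Context {R : realType}.

(** The supremum of the initial segment where [Q] holds cannot lie below the
    right end: there [Q] holds because it passes to left limits, and then it
    holds a bit further. *)
Lemma interval_induction (c d : R) (Q : R -> Prop) :
  Q c ->
  (forall u, c <= u < d -> Q u ->
     exists2 delta, 0 < delta & forall w, u < w < u + delta -> w <= d -> Q w) ->
  (forall u, c < u <= d -> (forall w, c <= w < u -> Q w) -> Q u) ->
  forall u, c <= u <= d -> Q u.
Proof.
move=> Qc Qright Qlim u /andP[cu ud].
pose A := [set s | c <= s <= d /\ forall w, c <= w <= s -> Q w].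
have Ac : A c by split=> [|w ?]; [lra | have -> : w = c by lra].
have Aub : has_sup A by split; [exists c | exists d => s [/andP[]]].
have cS : c <= sup A by apply: sup_upper_bound.
have Sd : sup A <= d by apply: ge_sup; [exists c | move=> s [/andP[]]].
have Qlt w : c <= w < sup A -> Q w.
  move=> /andP[cw wS]; have [|s [_ As] ws] := @sup_adherent R A (sup A - w) _ Aub.
    by rewrite subr_gt0.
  by apply: As; lra.
have QS : Q (sup A).
  by have [->//|ne] := eqVneq (sup A) c; apply: Qlim => //; rewrite lt_neqAle eq_sym ne cS.
have AS : A (sup A).
  split=> [|w /andP[cw]]; first by rewrite cS.
  by rewrite le_eqVlt => /orP[/eqP->//|wS]; apply: Qlt; rewrite cw.
suff Sd' : sup A = d by apply: AS.2; rewrite Sd' cu.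
apply/eqP; rewrite eq_le Sd /= leNgt; apply/negP => Sltd.
have [|delta d0 Qd] := Qright (sup A) _ QS; first by rewrite cS.
pose s := Num.min d (sup A + delta / 2).
have sle : s <= d /\ s <= sup A + delta / 2 by rewrite /s !ge_min !lexx orbT.
have Ss : sup A < s by rewrite /s lt_min Sltd /=; lra.
have : A s.
  split=> [|w /andP[cw ws]]; first by lra.
  by have [wS|Sw] := leP w (sup A); [apply: AS.2; rewrite cw | apply: Qd; lra].
by move=> /(sup_upper_bound Aub); lra.
Qed.

(** Germs are compared on an interval short enough for finitely many strict
    conditions at once. *)
Lemma pos_lower_bound (T : finType) (h : T -> R) :
  (forall x, 0 < h x) -> exists2 m : R, 0 < m & forall x, m <= h x.
Proof.
move=> h0; suff [m m0 mP] : exists2 m : R, 0 < m & forall x, x \in enum T -> m <= h x.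
  by exists m => // x; apply: mP; rewrite mem_enum.
elim: (enum T) => [|x s [m m0 IH]]; first by exists 1.
exists (Num.min m (h x)); first by rewrite lt_min m0 h0.
move=> y; rewrite inE ge_min => /orP[/eqP->|/IH->//]; by rewrite lexx orbT.
Qed.

End RealInduction.

(** * Germs *)

(** A tangent vector of a metric graph is treated as a germ [(a, u)]: an
    oriented edge [a] with a parameter [u], where [0 <= u < ell a.1], counted from
    the tail of [a].  Vertices and interior points of edges then need no separate
    treatment. *)
Section Germs.
Context {R : realType} {G : graph} (ell : edge G -> R).
Hypothesis ell_gt0 : forall e, 0 < ell e.
Implicit Types (a b : oarc G) (x : mpoint ell) (u : R).

Lemma opp_arcK a : opp_arc (opp_arc a) = a.
Proof. by case: a => e b; rewrite /opp_arc /= negbK. Qed.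

Lemma val_pt e u : 0 < u < ell e -> val (pt ell e u) = inr (e, u).
Proof. by move=> ue; rewrite /pt val_insubd /= ue. Qed.

Lemma pt0 e : pt ell e 0 = vert ell (ends e false).
Proof. by apply: val_inj; rewrite /pt val_insubd /= ltxx. Qed.

Lemma pt_ell e : pt ell e (ell e) = vert ell (ends e true).
Proof. by apply: val_inj; rewrite /pt val_insubd /= ltxx andbF ell_gt0. Qed.

(** The coordinate, along the reference orientation, of the point at parameter
    [u] on [a]. *)
Definition arc_coord a u : R := if a.2 then ell a.1 - u else u.

Lemma arc_pt_coord a u : arc_pt ell a u = pt ell a.1 (arc_coord a u).
Proof. by []. Qed.

Lemma arc_coord_in a u : 0 < u < ell a.1 -> 0 < arc_coord a u < ell a.1.
Proof. by rewrite /arc_coord; case: a.2 => ?; lra. Qed.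

Lemma arc_coord_cc a u : 0 <= u <= ell a.1 -> 0 <= arc_coord a u <= ell a.1.
Proof. by rewrite /arc_coord; case: a.2 => ?; lra. Qed.

Lemma arc_coordB a u w : `|arc_coord a u - arc_coord a w| = `|u - w|.
Proof.
rewrite /arc_coord; case: a.2 => //.
by rewrite (_ : _ - _ - _ = w - u) ?(distrC w); last ring.
Qed.

Lemma val_arc_pt a u : 0 < u < ell a.1 ->
  val (arc_pt ell a u) = inr (a.1, arc_coord a u).
Proof. by move=> ua; rewrite arc_pt_coord val_pt ?arc_coord_in. Qed.

Lemma arc_pt0 a : arc_pt ell a 0 = vert ell (arc_tail a).
Proof.
case: a => e [] /=; rewrite arc_pt_coord /arc_coord /= ?subr0 ?pt0 ?pt_ell //.
Qed.

Lemma arc_pt_opp a u : arc_pt ell (opp_arc a) (ell a.1 - u) = arc_pt ell a u.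
Proof.
by case: a => e [] /=; rewrite !arc_pt_coord /arc_coord /= ?subKr.
Qed.

Lemma arc_pt_ell a : arc_pt ell a (ell a.1) = vert ell (arc_head a).
Proof.
by rewrite -arc_pt_opp subrr arc_pt0; case: a.
Qed.

Lemma mem_tan_arc_pt a u : 0 <= u < ell a.1 -> a \in tan_arcs (arc_pt ell a u).
Proof.
rewrite le_eqVlt => /andP[/orP[/eqP<- _|u0 ul]]; rewrite /tan_arcs.
  by rewrite arc_pt0 /= inE.
by rewrite val_arc_pt ?u0 //= inE.
Qed.

Lemma tan_arc_pt_in a u : 0 < u < ell a.1 ->
  tan_arcs (arc_pt ell a u) = [set b : oarc G | b.1 == a.1]%SET.
Proof. by move=> ua; rewrite /tan_arcs val_arc_pt. Qed.

Lemma arc_pos_arc_pt a u : 0 <= u < ell a.1 -> arc_pos (arc_pt ell a u) a = u.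
Proof.
rewrite le_eqVlt => /andP[/orP[/eqP<- _|u0 ul]]; rewrite /arc_pos.
  by rewrite arc_pt0.
by rewrite val_arc_pt ?u0 //= /arc_coord; case: a.2 => //; rewrite subKr.
Qed.

Lemma arc_pos_bound x a : a \in tan_arcs x -> 0 <= arc_pos x a < ell a.1.
Proof.
case: x => -[v|[e t]] /= xP; rewrite /tan_arcs /arc_pos /= inE => aP.
  by rewrite lexx ell_gt0.
by rewrite (eqP aP); case: a.2; lra.
Qed.

Lemma arc_ptK x a : a \in tan_arcs x -> arc_pt ell a (arc_pos x a) = x.
Proof.
case: x => -[v|[e t]] /= xP; rewrite /tan_arcs /arc_pos /= inE => /eqP aP.
  by rewrite arc_pt0 aP; apply: val_inj.
subst e; apply: val_inj; rewrite arc_pt_coord /arc_coord /=.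
by case: a.2; rewrite ?subKr val_pt.
Qed.

Lemma advanceE x (nu : tangent x) h :
  advance nu h = arc_pt ell (val nu) (arc_pos x (val nu) + h).
Proof. by []. Qed.

Lemma tan_arcs_pair a u b : 0 < u < ell a.1 ->
  (b \in tan_arcs (arc_pt ell a u)) = (b == a) || (b == opp_arc a).
Proof.
move=> ua; rewrite tan_arc_pt_in // inE; case: a b {ua} => e [] [e' []] /=;
  by rewrite -!pair_eqE /= ?andbT ?andbF ?orbF.
Qed.

End Germs.

(** * The path metric near a point *)

Section PathMetric.
Context {R : realType} {G : graph} (ell : edge G -> R).
Hypothesis ellP : metric_graph ell.
Implicit Types (a b : oarc G) (x y : mpoint ell) (u h : R).

Lemma ell_gt0 e : 0 < ell e.
Proof. by case: ellP. Qed.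
Local Notation l0 := ell_gt0.

Lemma route_ge0 x y L : route x y L -> 0 <= L.
Proof. by elim=> // e s t K _ _ _ K0; rewrite addr_ge0 ?normr_ge0. Qed.

Lemma dist_le_route x y L : route x y L -> dist x y <= L.
Proof. by move=> xyL; apply: ge_inf => //; exists 0 => K /route_ge0. Qed.

Lemma dist_xx x : dist x x = 0.
Proof.
apply/eqP; rewrite eq_le dist_le_route; last exact: route_nil.
by apply: lb_le_inf => [|L /route_ge0//]; exists 0; apply: route_nil.
Qed.

Lemma route_arc x a s t L : 0 <= s <= ell a.1 -> 0 <= t <= ell a.1 ->
  route x (arc_pt ell a s) L -> route x (arc_pt ell a t) (L + `|t - s|).
Proof.
move=> sa ta; rewrite !arc_pt_coord -(arc_coordB ell a) => xL.
by apply: route_step xL; apply: arc_coord_cc.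
Qed.

Lemma dist_arc_le a s t : 0 <= s <= ell a.1 -> 0 <= t <= ell a.1 ->
  dist (arc_pt ell a s) (arc_pt ell a t) <= `|t - s|.
Proof.
move=> sa ta; apply: dist_le_route; rewrite -[X in route _ _ X]add0r.
by apply: route_arc => //; apply: route_nil.
Qed.

(** Without such routes [dist] would take the default value of the infimum of
    the empty set. *)
Lemma route_exists x y : exists L, route x y L.
Proof.
have [Gconn _ _] := ellP.
have vv v w : forall L, route x (vert ell v) L -> exists K, route x (vert ell w) K.
  move: (Gconn v w) => /connectP[p vp ->] {w}; elim: p v vp => [|w p IH] v /=.
    by move=> _ L; exists L.
  move=> /andP[/existsP[a /andP[/eqP<- /eqP<-]] wp] L xL; apply: (IH _ wp _).
  rewrite -(arc_pt0 l0) in xL; rewrite -(arc_pt_ell l0).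
  by apply: (@route_arc _ _ 0) xL; rewrite ?lexx ltW ?l0.
have [v [L xv]] : exists v L, route x (vert ell v) L.
  case: x {vv} => -[v|[e t]] xP.
    by exists v, 0; rewrite (_ : vert ell v = Point xP); [apply: route_nil | apply: val_inj].
  exists (ends e false), (0 + `|0 - t|); rewrite -(pt0 ell).
  have te := xP; rewrite /is_point in te.
  have xE : Point xP = pt ell e t by apply: val_inj; rewrite val_pt.
  apply: route_step; [by lra | by rewrite lexx ltW ?l0 |].
  by rewrite xE; apply: route_nil.
case: y => -[w|[e t]] yP.
  by rewrite (_ : Point yP = vert ell w); [apply: vv xv | apply: val_inj].
have [K xK] := vv v (ends e false) L xv.
have te := yP; rewrite /is_point in te.
exists (K + `|t - 0|); rewrite (_ : Point yP = pt ell e t); last first.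
  by apply: val_inj; rewrite val_pt.
apply: route_step; [by rewrite lexx ltW ?l0 | by lra |].
by rewrite pt0.
Qed.

Definition edge_fun (gv : vertex G -> R) (ge : edge G -> R -> R) x : R :=
  match val x with inl v => gv v | inr (e, t) => ge e t end.

Section Potential.
Variables (gv : vertex G -> R) (ge : edge G -> R -> R).
Hypothesis ge0E : forall e, ge e 0 = gv (ends e false).
Hypothesis ge_ellE : forall e, ge e (ell e) = gv (ends e true).

Lemma edge_fun_pt e t : 0 <= t <= ell e -> edge_fun gv ge (pt ell e t) = ge e t.
Proof.
move=> /andP[]; rewrite le_eqVlt => /orP[/eqP<-|t0]; first by rewrite pt0 ge0E.
rewrite le_eqVlt => /orP[/eqP->|te]; first by rewrite (pt_ell l0) ge_ellE.
by rewrite /edge_fun val_pt ?t0.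
Qed.

(** Lower bounds on distances all come from functions that are 1-Lipschitz
    along every edge. *)
Lemma potential_le_dist :
  (forall e s t, 0 <= s <= ell e -> 0 <= t <= ell e -> `|ge e t - ge e s| <= `|t - s|) ->
  forall x y, `|edge_fun gv ge y - edge_fun gv ge x| <= dist x y.
Proof.
move=> lip x y; apply: lb_le_inf => [|L]; first by have [L] := route_exists x y; exists L.
elim=> [|e s t K se te _ IH]; first by rewrite subrr normr0.
rewrite !edge_fun_pt // in IH *.
rewrite (_ : _ - _ = (ge e s - edge_fun gv ge x) + (ge e t - ge e s)); last ring.
by apply: le_trans (ler_normD _ _) _; rewrite lerD ?lip.
Qed.

End Potential.

Lemma max0B_lip (c s t : R) :
  `|Num.max 0 (c - t) - Num.max 0 (c - s)| <= `|t - s|.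
Proof.
rewrite ler_norml; have [|] := ger0P (t - s); have [] := lerP 0 (c - t);
 have [] := lerP 0 (c - s); lra.
Qed.

(** A tent over the stretch [[u, u + 2d]] of [a]: it measures the distance to
    [(a, u)] along this germ and vanishes on all the others. *)
Definition tent a u d x : R :=
  edge_fun (fun=> 0) (fun e t =>
    if e == a.1 then Num.max 0 (d - `|t - arc_coord ell a (u + d)|) else 0) x.

Lemma arc_coord0 a u : 0 <= u -> u <= ell a.1 ->
  `|0 - arc_coord ell a u| >= Num.min u (ell a.1 - u) /\
  `|ell a.1 - arc_coord ell a u| >= Num.min u (ell a.1 - u).
Proof.
move=> u0 ul; rewrite sub0r normrN /arc_coord !ge_min.
by case: a.2; rewrite ?subKr !ger0_norm ?lexx ?orbT //; lra.
Qed.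

Lemma tent_ends a u d e : 0 <= u -> 0 < d -> u + 2 * d <= ell a.1 ->
  ((if e == a.1 then Num.max 0 (d - `|0 - arc_coord ell a (u + d)|) else 0) = 0) /\
  ((if e == a.1 then Num.max 0 (d - `|ell e - arc_coord ell a (u + d)|) else 0) = 0).
Proof.
move=> u0 d0 udl; case: eqVneq => // ->; have ud0 : 0 <= u + d by lra.
have udl' : u + d <= ell a.1 by lra.
have [] := arc_coord0 ud0 udl'; rewrite !ge_min => c1 c2; split; apply/max_idPl; case/orP: c1; case/orP: c2; lra.
Qed.

Lemma tent_arc_pt a u d b w : 0 <= u -> 0 < d -> u + 2 * d <= ell a.1 ->
  0 <= w <= ell b.1 -> b.1 = a.1 ->
  tent a u d (arc_pt ell b w) =
  Num.max 0 (d - `|arc_coord ell b w - arc_coord ell a (u + d)|).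
Proof.
move=> u0 d0 udl wb ba; rewrite arc_pt_coord /tent edge_fun_pt ?ba ?eqxx //.
- by move=> e; apply: (tent_ends e u0 d0 udl).1.
- by move=> e; apply: (tent_ends e u0 d0 udl).2.
- by rewrite -ba; apply: arc_coord_cc.
Qed.

Lemma tent_other a u d b w : 0 <= u -> 0 < d -> u + 2 * d <= ell a.1 ->
  0 <= w <= ell b.1 -> b.1 != a.1 ->
  tent a u d (arc_pt ell b w) = 0.
Proof.
move=> u0 d0 udl wb /negPf ba; rewrite arc_pt_coord /tent edge_fun_pt ?ba //.
- by move=> e; apply: (tent_ends e u0 d0 udl).1.
- by move=> e; apply: (tent_ends e u0 d0 udl).2.
- by apply: arc_coord_cc.
Qed.

Lemma tent_le_dist a u d x y : 0 <= u -> 0 < d -> u + 2 * d <= ell a.1 ->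
  `|tent a u d y - tent a u d x| <= dist x y.
Proof.
move=> u0 d0 udl; apply: potential_le_dist => [e|e|e s t se te].
- by apply: (tent_ends e u0 d0 udl).1.
- by apply: (tent_ends e u0 d0 udl).2.
case: eqP => _; last by rewrite subrr normr0.
apply: le_trans (max0B_lip _ _ _) _; apply: le_trans (ler_dist_dist _ _) _.
by rewrite (_ : _ - _ - _ = t - s) //; ring.
Qed.

Lemma tent_up a u d h : 0 <= u -> 0 < d -> u + 2 * d <= ell a.1 ->
  0 <= h <= d -> tent a u d (arc_pt ell a (u + h)) = h.
Proof.
move=> u0 d0 udl hd; rewrite tent_arc_pt //; last by lra.
rewrite arc_coordB (_ : u + h - _ = - (d - h)) ?normrN; last ring.
by rewrite ger0_norm ?subKr ?max_r; lra.
Qed.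

(** The segment bounds the distance above, the tent over it bounds it below. *)
Lemma germ_dist x a : a \in tan_arcs x ->
  exists2 delta, 0 < delta & forall h h', 0 <= h < delta -> 0 <= h' < delta ->
    dist (arc_pt ell a (arc_pos x a + h)) (arc_pt ell a (arc_pos x a + h')) = `|h' - h|.
Proof.
move=> /(arc_pos_bound l0); move: (arc_pos x a) => u ua.
have [d d0 udl] : exists2 d, 0 < d & u + 2 * d <= ell a.1.
  by exists ((ell a.1 - u) / 4); lra.
exists d => // h h' hd hd'; apply/eqP; rewrite eq_le; apply/andP; split.
  rewrite (_ : h' - h = (u + h') - (u + h)); last ring.
  by apply: dist_arc_le; lra.
have u0 : 0 <= u by lra.
apply: (le_trans _ (tent_le_dist _ _ u0 d0 udl)).
by rewrite !tent_up // ?lexx; lra.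
Qed.

(** Two germs at a point are separated by the tent over one of them. *)
Lemma germ_sep x a b : a \in tan_arcs x -> b \in tan_arcs x -> a != b ->
  exists2 delta, 0 < delta & forall h h', 0 <= h < delta -> 0 <= h' < delta ->
    h <= dist (arc_pt ell b (arc_pos x b + h')) (arc_pt ell a (arc_pos x a + h)).
Proof.
move=> ax bx ab; have := arc_pos_bound l0 ax; have := arc_pos_bound l0 bx.
have pE : b = opp_arc a -> (arc_pos x a = 0 /\ arc_pos x b = 0) \/
    (0 < arc_pos x a /\ arc_pos x b = ell a.1 - arc_pos x a).
  move=> bE; subst b; case: x ax bx => -[v|[e t]] xP; rewrite /arc_pos /=; first by left.
  have te := xP; rewrite /is_point in te.
  rewrite /tan_arcs /= inE => /eqP ae _; subst e.
  by right; case: a.2 => /=; rewrite ?subKr; split=> //; lra.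
move: (arc_pos x a) (arc_pos x b) pE {ax bx} => u w pE wb ua.
(* the tent leaves room before the head of [a], where the other germ may start *)
pose d := (ell a.1 - u) / 4; have dE : d = (ell a.1 - u) / 4 by [].
move: d dE => d dE; have u0 : 0 <= u by lra.
have d0 : 0 < d by lra.
have udl : u + 2 * d <= ell a.1 by lra.
have [delta [dl dd dP]] : exists delta, [/\ 0 < delta, delta <= d &
    forall h', 0 <= h' < delta -> tent a u d (arc_pt ell b (w + h')) = 0]; last first.
  exists delta => // h h' hd hd'; apply: (le_trans _ (tent_le_dist _ _ u0 d0 udl)).
  rewrite dP // subr0 tent_up //; last by lra.
  by rewrite ger0_norm; lra.
have [ba|/eqP ba] := eqVneq b.1 a.1; last first.
  exists (Num.min d (ell b.1 - w)); split.
  - by rewrite lt_min d0; lra.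
  - by rewrite ge_min lexx.
  - by move=> h'; rewrite lt_min => hd; rewrite tent_other //; [lra | apply/eqP].
have {}ba : b = opp_arc a.
  case: a b ab ba {u d u0 d0 udl wb w pE ua dE} => e [] [e' []] //= ab ee;
    first [by rewrite ee eqxx in ab | by rewrite ee].
subst b; move: (pE erefl) => {pE}; case=> [[uE wE]|[{}u0 wE]]; subst w.
  exists d; split=> // h' hd; rewrite tent_arc_pt //=; last by lra.
  apply/max_idPl; rewrite subr_le0 /arc_coord /=.
  by case: a.2 => /=; [rewrite distrC|]; rewrite ger0_norm; lra.
exists (Num.min d u); split.
- by rewrite lt_min d0.
- by rewrite ge_min lexx.
move=> h'; rewrite lt_min => hd; rewrite tent_arc_pt //=; last 2 first.
- by lra.
- by lra.
apply/max_idPl; rewrite subr_le0 /arc_coord /=.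
by case: a.2 => /=; [|rewrite distrC]; rewrite ger0_norm; lra.
Qed.

(** The increments of [f] and [g] have opposite signs. *)
Lemma hat_sum_lip (f g : R -> R) s t :
  (forall s t, s <= t -> 0 <= f s - f t <= t - s) ->
  (forall s t, s <= t -> 0 <= g t - g s <= t - s) ->
  `|(f t + g t) - (f s + g s)| <= `|t - s|.
Proof.
move=> fP gP; wlog st : s t / s <= t => [H|].
  by have [/H//|/ltW/H] := leP s t; rewrite distrC (distrC s).
have := fP _ _ st; have := gP _ _ st.
by rewrite (ger0_norm (x := t - s)) ?subr_ge0 // ler_norml; lra.
Qed.

(** Small balls are stars, seen with the potential [d - dist x], truncated at
    [0]. *)
Lemma germ_ball x : exists2 delta, 0 < delta & forall y, dist x y < delta ->
  y = x \/ exists a, [/\ a \in tan_arcs x, 0 < dist x y &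
                         y = arc_pt ell a (arc_pos x a + dist x y)].
Proof.
have /(@choice _ _ _) [dl dlP] (nu : tangent x) : exists delta, 0 < delta /\
    forall h, 0 <= h < delta -> dist x (arc_pt ell (val nu) (arc_pos x (val nu) + h)) = h.
  have [delta d0 dP] := germ_dist (valP nu); exists delta; split=> // h hd.
  have := dP 0 h; rewrite addr0 (arc_ptK l0) ?(valP nu) // => ->; rewrite ?lexx ?subr0 //.
  by rewrite ger0_norm; lra.
have [d1 d10 d1P] := pos_lower_bound (fun nu => (dlP nu).1).
have [d2 d20 d2P] := pos_lower_bound ell_gt0.
suff [d d0 [dd1 dP]] : exists2 d, 0 < d & d <= d1 /\ forall y, dist x y < d ->
    y = x \/ exists a h, [/\ a \in tan_arcs x, 0 < h < d & y = arc_pt ell a (arc_pos x a + h)].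
  exists d => // y /dP[->|[a [h [ax hd yE]]]]; [by left|right; exists a].
  have yh : dist x y = h.
    by rewrite yE; apply: (dlP (exist _ a ax)).2; have := d1P (exist _ a ax); lra.
  by rewrite yh; split=> //; lra.
clear dl dlP d1P; case: x => -[v|[e0 t0]] xP.
  have [d [d0 dl1 dl2]] : exists d, [/\ 0 < d, d <= d1 & forall e, d <= ell e].
    exists (Num.min d1 d2); split=> [||e]; first by rewrite lt_min d10.
      by rewrite ge_min lexx.
    by apply: le_trans (d2P e); rewrite ge_min lexx orbT.
  pose hat := edge_fun (fun w => if w == v then d else 0) (fun e t =>
      (if ends e false == v then Num.max 0 (d - t) else 0) +
      (if ends e true == v then Num.max 0 (d - (ell e - t)) else 0)).
  have hatP y : `|hat y - hat (Point xP)| <= dist (Point xP) y.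
    apply: potential_le_dist => [e|e|e s t se te].
    - rewrite !subr0 (max_r (ltW d0)).
      by rewrite max_l ?subr_le0 // !if_same addr0.
    - rewrite !subrr subr0 (max_r (ltW d0)).
      by rewrite max_l ?subr_le0 // !if_same add0r.
    - apply: (hat_sum_lip (f := fun t => if _ then Num.max 0 (_ - t) else 0)
        (g := fun t => if _ then Num.max 0 (_ - (ell e - t)) else 0)) => s' t' st;
      case: eqP => _; rewrite ?subrr ?lexx ?subr_ge0 //.
      + by have [] := lerP 0 (d - s'); have [] := lerP 0 (d - t'); lra.
      + by have [] := lerP 0 (d - (ell e - s')); have [] := lerP 0 (d - (ell e - t')); lra.
  exists d => //; split=> // y /(le_lt_trans (hatP y)).
  rewrite /hat {2}/edge_fun /= eqxx distrC => /ltr_normlW.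
  rewrite ltrBlDl ltrDr => yd.
  case: y yd {hatP} => -[w|[e t]] yP; rewrite /edge_fun /=.
    by case: eqP => [wv|]; [left; apply: val_inj; rewrite /= wv | rewrite ltxx].
  have te := yP; rewrite /is_point in te.
  have yE : Point yP = pt ell e t by apply: val_inj; rewrite val_pt.
  move=> yd; have [[/eqP ev td]|[/eqP ev td]] :
      (ends e false == v /\ t < d) \/ (ends e true == v /\ ell e - t < d).
  - move: yd; case: eqP => _; case: eqP => _; rewrite ?addr0 ?add0r ?ltxx //;
    have [] := lerP 0 (d - t); have [] := lerP 0 (d - (ell e - t)); have [] := ltP t d;
    by move=> *; first [left; split=> //; lra | right; split=> //; lra | exfalso; lra].
  - right; exists (e, false), t; rewrite /tan_arcs /arc_pos /= inE /arc_tail /= ev eqxx.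
    by split=> //; [lra | rewrite add0r].
  - right; exists (e, true), (ell e - t).
    rewrite /tan_arcs /arc_pos /= inE /arc_tail /= ev eqxx.
    by split=> //; [lra | rewrite add0r arc_pt_coord /arc_coord /= subKr].
have te := xP; rewrite /is_point in te.
have [d [d0 dl1 dt0 dt1]] : exists d, [/\ 0 < d, d <= d1, d <= t0 & d <= ell e0 - t0].
  exists (Num.min d1 (Num.min t0 (ell e0 - t0))).
  by rewrite !lt_min !ge_min !lexx !orbT d10; split=> //; lra.
pose hat := edge_fun (fun w => 0) (fun e t =>
  if e == e0 then Num.max 0 (d - `|t - t0|) else 0).
have hatP y : `|hat y - hat (Point xP)| <= dist (Point xP) y.
  apply: potential_le_dist => [e|e|e s t se te'].
  - case: eqP => // _; rewrite sub0r normrN ger0_norm; last by lra.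
    by rewrite max_l // subr_le0.
  - case: eqP => // ->; rewrite ger0_norm; last by lra.
    by rewrite max_l // subr_le0.
  - case: eqP => _; last by rewrite subrr normr0.
    apply: le_trans (max0B_lip _ _ _) _; apply: le_trans (ler_dist_dist _ _) _.
    by rewrite (_ : _ - _ - _ = t - s) //; ring.
exists d => //; split=> // y /(le_lt_trans (hatP y)).
rewrite /hat {2}/edge_fun /= eqxx subrr normr0 subr0 (max_r (ltW d0)).
rewrite distrC => /ltr_normlW; rewrite ltrBlDl ltrDr => yd.
case: y yd {hatP} => -[w|[e t]] yP; rewrite /edge_fun /= ?ltxx //.
have te' := yP; rewrite /is_point in te'.
case: eqP => [ee|]; rewrite ?ltxx // => yd; subst e0.
have yE : Point yP = pt ell e t by apply: val_inj; rewrite val_pt.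
have {}yd : `|t - t0| < d by move: yd; have [] := lerP 0 (d - `|t - t0|); lra.
have [tt0|tt0|tt0] := ltgtP t t0.
- right; exists (e, true), (t0 - t); rewrite /tan_arcs /= inE /arc_pos /=.
  split=> //; first by move: yd; rewrite ltr0_norm; lra.
  by rewrite arc_pt_coord /arc_coord /= yE; congr pt; ring.
- right; exists (e, false), (t - t0); rewrite /tan_arcs /= inE /arc_pos /=.
  split=> //; first by move: yd; rewrite gtr0_norm; lra.
  by rewrite arc_pt_coord /arc_coord /= yE; congr pt; ring.
- by left; apply: val_inj; rewrite /= tt0.
Qed.

End PathMetric.

(** * Isometries and germs *)

Section Separation.
Context {R : realType} {G : graph} (ell : edge G -> R).
Hypothesis ellP : metric_graph ell.

Lemma germ_inj (x : mpoint ell) (a b : oarc G) :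
  a \in tan_arcs x -> b \in tan_arcs x ->
  (exists2 delta, 0 < delta & forall h, 0 < h < delta ->
     arc_pt ell a (arc_pos x a + h) = arc_pt ell b (arc_pos x b + h)) -> a = b.
Proof.
move=> ax bx [delta d0 abE]; apply/eqP/negP => /negP ab.
have [eps e0 /(_ (Num.min delta eps / 2) (Num.min delta eps / 2))] := germ_sep ellP ax bx ab.
have [m0 md me] : [/\ 0 < Num.min delta eps, Num.min delta eps <= delta & Num.min delta eps <= eps].
  by rewrite lt_min !ge_min !lexx orbT d0 e0.
by rewrite abE ?dist_xx //; lra.
Qed.

End Separation.

Section Isometry.
Context {R : realType} {G H : graph} {ell : edge G -> R} {ell' : edge H -> R}.
Hypotheses (ellP : metric_graph ell) (ellP' : metric_graph ell').

(** Moving along a germ at unit speed, the image stays at distance [h] from the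
    image point, hence on its star; it cannot change branches, since points at
    heights [h] and [h'] of two branches are at distance more than [|h - h'|]. *)
Lemma isometry_germ (phi : mpoint ell' -> mpoint ell) y a' :
  (forall x z, dist (phi x) (phi z) = dist x z) -> a' \in tan_arcs y ->
  exists2 a, a \in tan_arcs (phi y) &
    exists2 delta, 0 < delta & forall h, 0 < h < delta ->
      phi (arc_pt ell' a' (arc_pos y a' + h)) = arc_pt ell a (arc_pos (phi y) a + h).
Proof.
move=> phiP a'y; have [d1 d10 d1P] := germ_dist ellP' a'y.
have [d2 d20 d2P] := germ_ball ellP (phi y).
have /(@choice _ _ _) [dl dlP] (ab : tangent (phi y) * tangent (phi y)) :
    exists delta, 0 < delta /\ (ab.1 != ab.2 -> forall h h', 0 <= h < delta -> 0 <= h' < delta ->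
    h <= dist (arc_pt ell (val ab.2) (arc_pos (phi y) (val ab.2) + h'))
              (arc_pt ell (val ab.1) (arc_pos (phi y) (val ab.1) + h))).
  have [E|E] := eqVneq ab.1 ab.2; first by exists 1.
  have [delta d0 dP] := germ_sep ellP (valP ab.1) (valP ab.2) E.
  by exists delta.
have [d3 d30 d3P] := pos_lower_bound (fun ab => (dlP ab).1).
have [d [d0 dd1 dd2 dd3]] : exists d, [/\ 0 < d, d <= d1, d <= d2 & d <= d3].
  exists (Num.min d1 (Num.min d2 d3)).
  by rewrite !lt_min !ge_min !lexx !orbT d10 d20 d30.
have branch h : 0 < h < d -> exists nu : tangent (phi y),
    phi (arc_pt ell' a' (arc_pos y a' + h)) = arc_pt ell (val nu) (arc_pos (phi y) (val nu) + h).
  move=> hd; have yh : dist (phi y) (phi (arc_pt ell' a' (arc_pos y a' + h))) = h.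
    have := d1P 0 h; rewrite phiP addr0 (arc_ptK (ell_gt0 ellP')) // => ->; rewrite ?subr0 //; try lra.
    by rewrite ger0_norm; lra.
  have [|E|[a [ay _ E]]] := d2P (phi (arc_pt ell' a' (arc_pos y a' + h))); first by lra.
    by move: yh; rewrite E dist_xx //; lra.
  by exists (exist _ a ay); rewrite E yh.
have [nu0 nu0E] := branch (d / 2) ltac:(lra).
exists (val nu0); first exact: valP.
exists (d / 2); first by lra.
move=> h hd; have [|nu nuE] := branch h; first by lra.
suff -> : nu0 = nu by [].
apply/eqP/negP => /negP ne; have [_ /(_ ne) sep] := dlP (nu0, nu).
have /= := sep (d / 2) h; rewrite -nu0E -nuE phiP d1P; try lra.
have := d3P (nu0, nu) => d3nu; rewrite ger0_norm; last by lra.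
by move=> sep'; have := sep' ltac:(lra) ltac:(lra); lra.
Qed.

End Isometry.

Section Model.
Context {R : realType} {G H : graph} {ell : edge G -> R} {ell' : edge H -> R}.
Hypotheses (ellP : metric_graph ell) (ellP' : metric_graph ell').
Variable phi : mpoint ell' -> mpoint ell.
Hypothesis phiP : model phi.

Lemma model_inverse : exists psi : mpoint ell -> mpoint ell',
  [/\ cancel phi psi, cancel psi phi & forall x y, dist (psi x) (psi y) = dist x y].
Proof.
have [_ [psi phiK psiK] phiD] := phiP; exists psi; split=> // x y.
by rewrite -phiD !psiK.
Qed.

(** A model identifies the tangent vectors at a point with those at its image;
    [theta] is the inverse of the differential. *)
Lemma tangent_bij y : exists2 theta : tangent (phi y) -> tangent y, bijective theta &
  forall nu' nu, parallel nu' nu <-> nu' = theta nu.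
Proof.
have [psi [phiK psiK psiD]] := model_inverse; have [_ _ phiD] := phiP.
have fwd (nu' : tangent y) : exists nu : tangent (phi y), parallel nu' nu.
  have [a ay dP] := isometry_germ ellP ellP' phiD (valP nu').
  by exists (exist _ a ay).
have uniq nu' (nu1 nu2 : tangent (phi y)) : parallel nu' nu1 -> parallel nu' nu2 -> nu1 = nu2.
  move=> [d1 d10 d1P] [d2 d20 d2P]; apply: val_inj; apply: (germ_inj ellP (valP nu1) (valP nu2)).
  exists (Num.min d1 d2); first by rewrite lt_min d10.
  move=> h; rewrite lt_min => /and3P[h0 hd1 hd2].
  by rewrite -[LHS]/(advance nu1 h) -[RHS]/(advance nu2 h) -d1P ?h0 // -d2P ?h0.
have uniq' (nu1 nu2 : tangent y) (nu : tangent (phi y)) : parallel nu1 nu -> parallel nu2 nu -> nu1 = nu2.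
  move=> [d1 d10 d1P] [d2 d20 d2P]; apply: val_inj; apply: (germ_inj ellP' (valP nu1) (valP nu2)).
  exists (Num.min d1 d2); first by rewrite lt_min d10.
  move=> h; rewrite lt_min => /and3P[h0 hd1 hd2]; apply: (can_inj phiK).
  by rewrite [LHS]d1P ?h0 // [RHS]d2P ?h0.
have back (nu : tangent (phi y)) : exists nu' : tangent y, parallel nu' nu.
  have [a' ay] := isometry_germ ellP' ellP psiD (valP nu).
  rewrite phiK in ay * => -[delta d0 dP]; exists (exist _ a' ay), delta => // h hd.
  by rewrite advanceE /= -dP // psiK.
have [theta thetaP] := choice back.
have thetaE nu' nu : parallel nu' nu <-> nu' = theta nu.
  by split=> [/uniq'|->]; [apply|].
exists theta => //; have [eta etaP] := choice fwd; exists eta => [nu|nu'].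
  by apply: uniq (etaP _) (thetaP _).
by symmetry; apply/thetaE.
Qed.

End Model.

(** * Slopes of rational functions *)

Section Slopes.
Context {R : realType} {G : graph} (ell : edge G -> R).
Hypothesis ellP : metric_graph ell.
Implicit Types (a b : oarc G) (x y : mpoint ell) (u h : R) (f : mpoint ell -> R).
Local Notation l0 := (ell_gt0 ellP).

Definition germ_slope f a u (m : int) : Prop :=
  exists2 delta : R, 0 < delta & forall h, 0 < h < delta ->
    f (arc_pt ell a (u + h)) = f (arc_pt ell a u) + m%:~R * h.

Definition arc_slope f a u : int := xget 0 [set m | germ_slope f a u m].

Lemma germ_slope_uniq f a u m m' :
  germ_slope f a u m -> germ_slope f a u m' -> m = m'.
Proof.
move=> [d d0 dP] [d' d0' dP']; have [h [h0 hd hd']] : exists h, [/\ 0 < h, h < d & h < d'].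
  exists (Num.min d d' / 2).
  have m0 : 0 < Num.min d d' by rewrite lt_min d0.
  have [] : Num.min d d' <= d /\ Num.min d d' <= d' by rewrite !ge_min !lexx orbT.
  by split; lra.
have := dP h; have := dP' h; rewrite h0 hd hd' => -> // /(_ isT) /addrI/mulIf.
by rewrite gt_eqF // => /(_ isT)/intr_inj.
Qed.

Lemma arc_slopeE f a u m : germ_slope f a u m -> arc_slope f a u = m.
Proof. by move=> fm; apply: xget_subset1 => // ? ?; apply: germ_slope_uniq. Qed.

Lemma slope_arc f x (nu : tangent x) :
  slope f nu = arc_slope f (val nu) (arc_pos x (val nu)).
Proof.
rewrite /slope /arc_slope; congr xget; apply/seteqP; split=> m [d d0 dP];
  exists d => // h hd; have := dP h hd; by rewrite advanceE (arc_ptK l0) // (valP nu).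
Qed.

(** The slope persists on a short stretch, where it is also, up to sign, the
    slope in the opposite direction. *)
Lemma germ_slope_next f a u m : germ_slope f a u m ->
  exists2 delta, 0 < delta & forall w, u < w < u + delta ->
    germ_slope f a w m /\ germ_slope f (opp_arc a) (ell a.1 - w) (- m).
Proof.
move=> [d d0 dP]; exists d => // w wd.
have fw : f (arc_pt ell a w) = f (arc_pt ell a u) + m%:~R * (w - u).
  by rewrite -dP ?(addrC u) ?subrK; lra.
split.
  exists (u + d - w) => [|h hd]; first by lra.
  by rewrite (_ : w + h = u + (w - u + h)) ?dP ?fw; [ring | lra | ring].
exists (w - u) => [|h hd]; first by lra.
rewrite arc_pt_opp (_ : ell a.1 - w + h = ell a.1 - (w - h)); last ring.
rewrite arc_pt_opp (_ : w - h = u + (w - u - h)); last ring.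
by rewrite dP ?fw ?rmorphN /=; [ring | lra].
Qed.

(** By continuity, the affine expression found just after a point also gives
    the value at this point. *)
Lemma affine_germ_slope f a u (d : R) (m : int) (c : R) :
  continuous_fun f -> 0 <= u -> 0 < d -> u + d <= ell a.1 ->
  (forall h, 0 < h < d -> f (arc_pt ell a (u + h)) = m%:~R * h + c) ->
  germ_slope f a u m.
Proof.
move=> fcont u0 d0 udl fP; exists d => // h hd; rewrite fP // addrC; congr (_ + _).
apply/eqP; rewrite -subr_eq0; apply/negPn/negP => ne.
have [eps e0 eE] : exists2 eps, 0 < eps & eps = `|c - f (arc_pt ell a u)|.
  by eexists; last by []; rewrite normr_gt0.
have [eta eta0 etaP] := fcont (arc_pt ell a u) (eps / 2) ltac:(lra).
have [k k0 kE] : exists2 k, 0 < k & k = `|m%:~R : R| + 1.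
  by eexists; last by []; have := normr_ge0 (m%:~R : R); lra.
have [q [q0 qd qe qk]] : exists q, [/\ 0 < q, q < d, q < eta & k * q <= eps / 2].
  exists (Num.min d (Num.min eta (eps / k)) / 2).
  have ek : 0 < eps / k by rewrite divr_gt0.
  have : 0 < Num.min d (Num.min eta (eps / k)) by rewrite !lt_min d0 eta0.
  have : Num.min d (Num.min eta (eps / k)) <= d by rewrite ge_min lexx.
  have : Num.min d (Num.min eta (eps / k)) <= eta by rewrite !ge_min lexx orbT.
  have : Num.min d (Num.min eta (eps / k)) <= eps / k by rewrite !ge_min lexx !orbT.
  move: (Num.min _ _) => q q1 q2 q3 q4; split; try lra.
  move: q1; rewrite ler_pdivlMr // => q1; lra.
have : dist (arc_pt ell a u) (arc_pt ell a (u + q)) < eta.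
  apply: le_lt_trans (dist_arc_le _ _) _; try lra.
  by rewrite addrAC subrr add0r gtr0_norm.
move=> /etaP; rewrite fP ?q0 // => lt1.
have lt2 : `|m%:~R * q| <= eps / 2 - q by rewrite normrM (gtr0_norm q0); move: qk; rewrite kE; lra.
have := ler_normD (m%:~R * q + c - f (arc_pt ell a u)) (- (m%:~R * q)).
rewrite normrN (_ : _ + _ = c - f (arc_pt ell a u)); [lra | ring].
Qed.

Lemma step_index (t : nat -> R) N u : t 0%N <= u -> u < t N ->
  exists2 i, (i < N)%N & t i <= u < t i.+1.
Proof.
elim: N => [|N IH] tu ut; first by lra.
have [/(IH tu)[i iN iP]|Nu] := ltP u (t N); last by exists N => //; rewrite Nu.
by exists i => //; apply: leqW.
Qed.

Lemma step_index_left (t : nat -> R) N u : t 0%N < u -> u <= t N ->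
  exists2 i, (i < N)%N & t i < u <= t i.+1.
Proof.
elim: N => [|N IH] tu ut; first by lra.
have [/(IH tu)[i iN iP]|Nu] := leP u (t N); last by exists N => //; rewrite Nu.
by exists i => //; apply: leqW.
Qed.

Lemma Rat_germ_slope f a u : Defs.Rat f -> 0 <= u < ell a.1 ->
  germ_slope f a u (arc_slope f a u).
Proof.
move=> [fcont /(_ a.1)[N [t [m [c [t0 tN tlt fP]]]]]] ua.
suff [k fk] : exists k, germ_slope f a u k by rewrite (arc_slopeE fk).
case: a ua tN fP => e [] /= ua tN fP.
  have [||i iN iP] := @step_index_left t N (ell e - u); rewrite ?t0 ?tN; try lra.
  exists (- m i).
  apply: (@affine_germ_slope _ _ _ (ell e - u - t i) _ ((m i)%:~R * (ell e - u) + c i)) => //=; try lra.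
    have : 0 <= t i by clear -iN t0 tlt; elim: i iN => [|i IH] iN; rewrite ?t0 //;
      have := tlt i (ltnW iN); have := IH (ltnW iN); lra.
    by lra.
  move=> h hd; rewrite arc_pt_coord /arc_coord /= (fP _ iN); last by lra.
  by rewrite rmorphN /=; ring.
have [||i iN iP] := @step_index t N u; rewrite ?t0 ?tN; try lra.
exists (m i); apply: (@affine_germ_slope _ _ _ (t i.+1 - u) _ ((m i)%:~R * u + c i)) => //=; try lra.
  suff : forall j, (i.+1 + j <= N)%N -> t i.+1 <= t (i.+1 + j)%N.
    by move=> /(_ (N - i.+1)%N); rewrite subnKC // tN => /(_ (leqnn _)); lra.
  elim=> [|j IH]; rewrite ?addn0 // addnS => jN; have := tlt _ jN; have := IH (ltnW jN); lra.
move=> h hd; rewrite arc_pt_coord /arc_coord /= (fP _ iN); [ring | lra].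
Qed.

Lemma ord_at_arc f x : ord_at f x = - \sum_(a in tan_arcs x) arc_slope f a (arc_pos x a).
Proof.
rewrite /ord_at [in RHS]big_sub; congr (- _).
by apply: eq_bigr => nu _; rewrite slope_arc.
Qed.

Lemma sum_tan_arcs_in (F : oarc G -> int) a u : 0 < u < ell a.1 ->
  \sum_(b in tan_arcs (arc_pt ell a u)) F b = F a + F (opp_arc a).
Proof.
move=> ua; rewrite (eq_bigl (mem [set a; opp_arc a]%SET)) => [|b]; last first.
  by rewrite /= (tan_arcs_pair b ua) !inE.
rewrite big_setU1 ?big_set1 // inE -pair_eqE /= eqxx /=; by case: a.2.
Qed.

Lemma arc_pos_opp a u : 0 < u < ell a.1 ->
  arc_pos (arc_pt ell a u) (opp_arc a) = ell a.1 - u.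
Proof. by move=> ua; rewrite -arc_pt_opp (arc_pos_arc_pt l0) //=; lra. Qed.

Section Concave.
Variable D : divisor ell.
Hypothesis hD : forall x, D x <> 0 -> exists v, x = vert ell v.

Lemma RatD_opp_slope f a u : RatD D f -> 0 < u < ell a.1 ->
  arc_slope f a u + arc_slope f (opp_arc a) (ell a.1 - u) <= 0.
Proof.
move=> [_ /(_ (arc_pt ell a u))] + ua; rewrite ord_at_arc sum_tan_arcs_in //.
have -> : D (arc_pt ell a u) = 0.
  apply/eqP/negPn/negP => /eqP/hD[v] /(congr1 val); by rewrite val_arc_pt.
by rewrite (arc_pos_arc_pt l0) ?arc_pos_opp //; lra.
Qed.

(** Functions of [RatD D] are concave on every edge: the tangent line at one
    point lies above the graph.  The induction carries along that no later slope
    exceeds the first one: going right a slope persists, and at the next point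
    it can only drop. *)
Lemma RatD_tangent_line f a u0 : RatD D f -> 0 <= u0 < ell a.1 ->
  forall u, u0 <= u <= ell a.1 ->
  f (arc_pt ell a u) <= f (arc_pt ell a u0) + (arc_slope f a u0)%:~R * (u - u0).
Proof.
move=> fD ua; have [fR _] := fD.
pose Q u := f (arc_pt ell a u) <= f (arc_pt ell a u0) + (arc_slope f a u0)%:~R * (u - u0)
  /\ (u < ell a.1 -> arc_slope f a u <= arc_slope f a u0).
suff QP u : u0 <= u <= ell a.1 -> Q u by move=> u /QP[].
apply: interval_induction => [|w wu [Qw /(_ ltac:(lra)) sw]|w wu Qw].
- by split=> //; rewrite subrr mulr0 addr0.
- have [|d1 d10 d1P] := @Rat_germ_slope f a w fR; first by lra.
  have [|d2 d20 d2P] := germ_slope_next (@Rat_germ_slope f a w fR _); first by lra.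
  exists (Num.min d1 d2) => [|v vw vl]; first by rewrite lt_min d10.
  have {vw} [wv vd1 vd2] : [/\ w < v, v < w + d1 & v < w + d2].
    move: vw; have : Num.min d1 d2 <= d1 /\ Num.min d1 d2 <= d2 by rewrite !ge_min !lexx orbT.
    by case=> ? ? ?; split; lra.
  have [vs _] := d2P v ltac:(lra).
  split=> [|_]; last by rewrite (arc_slopeE vs).
  rewrite (_ : v = w + (v - w)); last ring.
  rewrite d1P; last by lra.
  have : (arc_slope f a w)%:~R * (v - w) <= (arc_slope f a u0)%:~R * (v - w) :> R.
    by rewrite ler_wpM2r ?ler_int // subr_ge0 ltW.
  by lra.
- pose s' := arc_slope f (opp_arc a) (ell a.1 - w).
  have sP : germ_slope f (opp_arc a) (ell a.1 - w) s'.
    by apply: Rat_germ_slope => //=; lra.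
  have [d1 d10 d1P] := sP; have [d2 d20 d2P] := germ_slope_next sP.
  have [h [h0 hd1 hd2 hw]] : exists h, [/\ 0 < h, h < d1, h < d2 & h < w - u0].
    exists (Num.min d1 (Num.min d2 (w - u0)) / 2).
    have : 0 < Num.min d1 (Num.min d2 (w - u0)) by rewrite !lt_min d10 d20; lra.
    have : Num.min d1 (Num.min d2 (w - u0)) <= d1 by rewrite ge_min lexx.
    have : Num.min d1 (Num.min d2 (w - u0)) <= d2 by rewrite !ge_min lexx orbT.
    have : Num.min d1 (Num.min d2 (w - u0)) <= w - u0 by rewrite !ge_min lexx !orbT.
    by move: (Num.min _ _) => q *; split; lra.
  have [fh /(_ ltac:(lra)) sh] := Qw (w - h) ltac:(lra).
  have := d1P h ltac:(lra); rewrite (_ : _ - _ + h = ell a.1 - (w - h)); last ring.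
  rewrite !arc_pt_opp => fwh.
  have [_] := d2P (ell a.1 - w + h) ltac:(lra).
  rewrite opp_arcK (_ : ell _ - _ = w - h) /=; last ring.
  move=> /arc_slopeE sE; rewrite {}sE in sh; have {}sh : (- s')%:~R <= (arc_slope f a u0)%:~R :> R.
    by rewrite ler_int.
  split=> [|wl].
    have : (- s')%:~R * h <= (arc_slope f a u0)%:~R * h :> R by rewrite ler_wpM2r // ltW.
    by rewrite rmorphN /=; lra.
  have := RatD_opp_slope fD (a := a) (u := w) ltac:(lra).
  by move: sh; rewrite ler_int -/s'; lra.
Qed.

(** The increment of [f] between the two points is bounded by the tangent lines
    at both. *)
Lemma RatD_slope_mono f a u1 u2 : RatD D f -> 0 <= u1 -> u1 < u2 -> u2 <= ell a.1 ->
  - arc_slope f (opp_arc a) (ell a.1 - u2) <= arc_slope f a u1.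
Proof.
move=> fD u10 u12 u2l.
have T1 := RatD_tangent_line fD (a := a) (u0 := u1) ltac:(lra) (u := u2) ltac:(lra).
have := RatD_tangent_line fD (a := opp_arc a) (u0 := ell a.1 - u2) ltac:(rewrite /=; lra)
  (u := ell a.1 - u1) ltac:(rewrite /=; lra).
rewrite !arc_pt_opp (_ : _ - _ - _ = u2 - u1); last ring.
rewrite -(ler_int R) rmorphN /= -(ler_pM2r (x := u2 - u1)) ?subr_gt0 //; lra.
Qed.

End Concave.

End Slopes.

(** * Slopes of functions with prescribed poles are bounded *)

Section SlopeBound.
Context {R : realType} {G : graph} (ell : edge G -> R).
Hypothesis ellP : metric_graph ell.
Variable D : divisor ell.
Hypothesis hD : forall x, D x <> 0 -> exists v, x = vert ell v.
Implicit Types (a b : oarc G) (v w : vertex G) (u h : R) (f : mpoint ell -> R).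
Local Notation l0 := (ell_gt0 ellP).

Lemma RatD_out_slopes f v : RatD D f ->
  \sum_(a in out_arcs v) arc_slope f a 0 <= D (vert ell v).
Proof.
by move=> [_ /(_ (vert ell v))]; rewrite ord_at_arc // subr_ge0.
Qed.

Lemma RatD_edge_le f a : RatD D f ->
  f (vert ell (arc_head a)) <= f (vert ell (arc_tail a)) + (arc_slope f a 0)%:~R * ell a.1.
Proof.
move=> fD; have := RatD_tangent_line ellP hD fD (a := a) (u0 := 0) _ (u := ell a.1) _.
by rewrite (arc_pt0 l0) (arc_pt_ell l0) subr0; apply; rewrite lexx ?l0 ?ltW ?l0.
Qed.

Definition inv_len : R := \sum_(a : oarc G) (ell a.1)^-1.

(** At a vertex where [f] is almost minimal no outgoing slope is very negative;
    as their sum is at most [D v], none is very large either. *)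
Lemma RatD_out_slope_bounds f v a (K : R) : RatD D f -> 0 <= K ->
  (forall w, f (vert ell v) <= f (vert ell w) + K) -> a \in out_arcs v ->
  (arc_slope f a 0)%:~R <= (D (vert ell v))%:~R + K * inv_len.
Proof.
move=> fD K0 fK av; have := RatD_out_slopes v fD.
rewrite -(ler_int R) rmorph_sum (bigD1 a) //= => le1.
have : \sum_(b in out_arcs v | b != a) - (K / ell b.1) <=
       \sum_(b in out_arcs v | b != a) (arc_slope f b 0)%:~R.
  apply: ler_sum => b /andP[]; rewrite inE => /eqP bv _.
  rewrite -(ler_pM2r (l0 b.1)) mulNr divfK ?gt_eqF ?l0 //.
  by have := RatD_edge_le b fD; have := fK (arc_head b); rewrite bv; lra.
have : \sum_(b in out_arcs v | b != a) (K / ell b.1) <= K * inv_len.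
  rewrite /inv_len mulr_sumr [leRHS](bigID (fun b => (b \in out_arcs v) && (b != a))) /=.
  by rewrite lerDl sumr_ge0 // => b _; rewrite mulr_ge0 // invr_ge0 ltW ?l0.
by rewrite sumrN; lra.
Qed.

Definition tot_len : R := \sum_(a : oarc G) ell a.1.

Lemma ell_le_tot a : ell a.1 <= tot_len.
Proof.
rewrite /tot_len (bigD1 a) //= lerDl sumr_ge0 // => b _; by rewrite ltW ?l0.
Qed.

(** Starting at a minimum, the bound propagates from a vertex to its
    neighbours, hence to the whole connected graph. *)
Lemma RatD_vertex_bound v w : exists K : R, 0 <= K /\ forall f, RatD D f ->
  (forall w', f (vert ell v) <= f (vert ell w')) ->
  f (vert ell w) <= f (vert ell v) + K.
Proof.
pose bd w (K : R) := 0 <= K /\ forall f, RatD D f ->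
  (forall w', f (vert ell v) <= f (vert ell w')) -> f (vert ell w) <= f (vert ell v) + K.
have [Gconn _ _] := ellP; move: (Gconn v w) => /connectP[p pP ->].
suff bdp w1 : path (@adjacent G) w1 p -> (exists K, bd w1 K) -> exists K, bd (last w1 p) K.
  by apply: bdp pP _; exists 0; split=> // f _ _; rewrite addr0.
elim: p w1 {pP} => [|w2 p IH] w1 //= /andP[/existsP[a /andP[/eqP a1 /eqP a2]] pP] [K [K0 KP]].
apply: IH pP _.
pose C := `|(D (vert ell w1))%:~R| + K * inv_len.
have L0 : 0 <= tot_len by apply: le_trans (ell_le_tot a); rewrite ltW ?l0.
have C0 : 0 <= C.
  rewrite addr_ge0 // mulr_ge0 // sumr_ge0 // => b _; by rewrite invr_ge0 ltW ?l0.
exists (K + C * tot_len); split=> [|f fD fmin]; first by rewrite addr_ge0 // mulr_ge0.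
have := KP f fD fmin; have := RatD_edge_le a fD; rewrite a1 a2 => le1 le2.
have sC : (arc_slope f a 0)%:~R <= C.
  apply: le_trans (RatD_out_slope_bounds (v := w1) fD K0 _ _) _.
  - by move=> w'; have := fmin w'; lra.
  - by rewrite inE a1.
  - by rewrite lerD2r ler_norm.
have : (arc_slope f a 0)%:~R * ell a.1 <= C * ell a.1 by apply: ler_wpM2r => //; rewrite ltW ?l0.
have : C * ell a.1 <= C * tot_len by apply: ler_wpM2l => //; apply: ell_le_tot.
lra.
Qed.

(** Once the values at the vertices are bounded, so are the slopes at both ends
    of every edge, and by concavity all those in between. *)
Lemma RatD_slope_bounded : exists B : nat, forall f a u, RatD D f ->
  0 <= u < ell a.1 -> `|arc_slope f a u| <= B%:Z.
Proof.
have [_ /card_gt0P[e0 _] _] := ellP.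
have /(@choice _ _ _) [K KP] (vw : vertex G * vertex G) := RatD_vertex_bound vw.1 vw.2.
pose K1 := \sum_vw K vw; have KK1 vw : K vw <= K1.
  by rewrite /K1 (bigD1 vw) //= lerDl sumr_ge0 // => vw' _; case: (KP vw').
have K10 : 0 <= K1 by rewrite sumr_ge0 // => vw _; case: (KP vw).
have osc f v w : RatD D f -> f (vert ell v) <= f (vert ell w) + K1.
  move=> fD; pose v0 := [arg min_(v' < ends e0 true) f (vert ell v')]%O.
  have v0P w' : f (vert ell v0) <= f (vert ell w') by rewrite /v0; case: arg_minP => // i _; apply.
  have [_ /(_ f fD v0P) /=] := KP (v0, v); have := KK1 (v0, v); have := v0P w; lra.
have [C C0] : exists C : R, forall f a, RatD D f -> (arc_slope f a 0)%:~R <= C.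
  exists (\sum_v `|(D (vert ell v))%:~R| + K1 * inv_len) => f a fD; apply: le_trans (RatD_out_slope_bounds (v := arc_tail a) fD K10 _ _) _.
  - by move=> w; apply: osc.
  - by rewrite inE.
  - rewrite lerD2r; apply: le_trans (ler_norm _) _.
    by rewrite (bigD1 (arc_tail a)) //= lerDl sumr_ge0.
have [B BP] : exists B : nat, C <= B%:R.
  by exists (Num.bound `|C|); apply: le_trans (ler_norm _) _; apply/ltW/archi_boundP.
exists B => f a u fD ua.
have up b (t : R) : 0 <= t < ell b.1 -> (arc_slope f b t <= B%:Z) && (- B%:Z <= arc_slope f b t).
  move=> tb; rewrite -2!(ler_int R) rmorphN /=.
  have := C0 f b fD; have := C0 f (opp_arc b) fD.
  have : arc_slope f b t <= arc_slope f b 0.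
    have [->//|t0] := eqVneq t 0.
    have := RatD_slope_mono ellP hD fD (a := b) (u1 := 0) (u2 := t) (lexx _) ltac:(rewrite lt_def t0; lra) ltac:(lra).
    have := RatD_opp_slope ellP hD fD (a := b) (u := t) ltac:(rewrite lt_def t0; lra).
    by move=> le1 le2; apply: le_trans le2; rewrite -subr_le0 opprK.
  have : - arc_slope f (opp_arc b) 0 <= arc_slope f b t.
    have := RatD_slope_mono ellP hD fD (a := b) (u1 := t) (u2 := ell b.1) ltac:(lra) ltac:(lra) (lexx _).
    by rewrite subrr.
  rewrite -2!(ler_int R) rmorphN /=.
  clear -BP; move: (_%:~R) (_%:~R) (_%:~R) => s1 s2 s3; lra.
by have /andP[] := up a u ua; rewrite ler_norml => -> ->.
Qed.

End SlopeBound.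

(** * Rank functions *)

Section RankFunctions.
Variable r : nat.

(** The standard rank is a convex decreasing function of the sum of the
    coordinates; replacing two points by their maximum and minimum keeps the
    total of the two sums and spreads them. *)
Lemma standard_rank_function (I : finType) : rank_function (@standard_rank r I).
Proof.
have axisE i (t : 'I_r.+1) : (\sum_j (@cube_axis r I t i j : nat) = t)%N.
  rewrite (bigD1 i) //= ffunE eqxx big1 ?addn0 // => j /negPf ji; by rewrite ffunE ji.
split=> [i t|a b ab|a b|a]; rewrite /standard_rank.
- rewrite axisE max_r //; have := ltn_ord t; lia.
- have : (\sum_i (a i : nat) <= \sum_i (b i : nat))%N by apply: leq_sum => i _; apply: ab.
  lia.
- have : (\sum_i (a i : nat) + \sum_i (b i : nat) =
     \sum_i (cube_max a b i : nat) + \sum_i (cube_min a b i : nat))%N.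
    rewrite -!big_split /=; apply: eq_bigr => i _; rewrite !ffunE.
    by rewrite /Order.max /Order.min; case: ifP => // _; rewrite addnC.
  have : (\sum_i (cube_min a b i : nat) <= \sum_i (a i : nat))%N.
    by apply: leq_sum => i _; rewrite ffunE; have : (Order.min (a i) (b i) <= a i)%O by rewrite ge_min lexx.
  have : (\sum_i (cube_min a b i : nat) <= \sum_i (b i : nat))%N.
    by apply: leq_sum => i _; rewrite ffunE; have : (Order.min (a i) (b i) <= b i)%O by rewrite ge_min lexx orbT.
  move: (\sum_i a i)%N (\sum_i b i)%N (\sum_i cube_min a b i)%N (\sum_i cube_max a b i)%N => A B m M.
  lia.
- lia.
Qed.

Definition cube_comp (I J : finType) (theta : J -> I) (a : cube r I) : cube r J :=
  [ffun j => a (theta j)].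

Lemma rank_function_comp (I J : finType) (theta : J -> I) (rho : cube r J -> int) :
  bijective theta -> rank_function rho -> rank_function (rho \o cube_comp theta).
Proof.
move=> [eta thetaK etaK] [rho1 rho2 rho3 rho4]; split=> [i t|a b ab|a b|a] //=.
- rewrite -(rho1 (eta i)); congr rho; apply/ffunP => j; rewrite !ffunE.
  by rewrite -[in LHS](etaK i) (can_eq thetaK).
- by apply: rho2 => j; rewrite !ffunE; apply: ab.
- rewrite (_ : cube_comp _ (cube_max a b) = cube_max (cube_comp theta a) (cube_comp theta b)).
    rewrite (_ : cube_comp _ (cube_min a b) = cube_min (cube_comp theta a) (cube_comp theta b)) //.
    by apply/ffunP => j; rewrite !ffunE.
  by apply/ffunP => j; rewrite !ffunE.
Qed.

(** If all points of the antidiagonal of the square are jumps then [rho] is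
    standard.  Two consecutive points of the antidiagonal have a common
    successor, so [rho] is constant along it, equal to its value [0] at the
    corner; hence it is [-1] beyond, and supermodularity propagates the drop
    by one below. *)
Lemma rank_standard_of_antidiagonal (I : finType) (i j : I) (rho : cube r I -> int) :
  i != j -> (forall k, (k == i) || (k == j)) -> rank_function rho ->
  (forall k : 'I_r.+1, jump rho [ffun l => if l == i then rev_ord k else k]) ->
  rho =1 standard_rank.
Proof.
move=> ij Iij [rho1 rho2 rho3 rho4] jumpP.
pose P (x y : nat) : cube r I := [ffun k => if k == i then inord x else inord y].
have Pi x y : P x y i = inord x by rewrite ffunE eqxx.
have Pj x y : P x y j = inord y by rewrite ffunE eq_sym (negPf ij).
have ext (a b : cube r I) : a i = b i -> a j = b j -> a = b.
  by move=> ai aj; apply/ffunP => k; case/orP: (Iij k) => /eqP->.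
have inK (x : nat) : (x <= r)%N -> (inord x : 'I_r.+1) = x :> nat by move=> xr; rewrite inordK.
have gx x : (x <= r)%N -> rho (P x 0%N) = r%:Z - x%:Z.
  move=> xr; rewrite -[in RHS](inK x xr) -(rho1 i); congr rho; apply: ext; rewrite ?Pi ?Pj ffunE ?eqxx //.
  by rewrite eq_sym (negPf ij); apply: val_inj; rewrite /= inK.
have gy y : (y <= r)%N -> rho (P 0%N y) = r%:Z - y%:Z.
  move=> yr; rewrite -[in RHS](inK y yr) -(rho1 j); congr rho; apply: ext; rewrite ?Pi ?Pj ffunE ?eqxx //.
  by rewrite (negPf ij); apply: val_inj; rewrite /= inK.
have sup x y x' y' : (x <= x' <= r)%N -> (y' <= y <= r)%N ->
    rho (P x y) + rho (P x' y') <= rho (P x' y) + rho (P x y').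
  move=> xx yy; have := rho3 (P x y) (P x' y').
  rewrite (_ : cube_max _ _ = P x' y) 1?(_ : cube_min _ _ = P x y') //;
    apply: ext; rewrite ffunE ?Pi ?Pj; apply: val_inj; rewrite /Order.max /Order.min ltEord /=;
    case: ltnP; rewrite !inK; lia.
have mono x y x' y' : (x <= x' <= r)%N -> (y <= y' <= r)%N -> rho (P x' y') <= rho (P x y).
  move=> xx yy; apply: rho2 => k; case/orP: (Iij k) => /eqP->; rewrite ?Pi ?Pj !inK; lia.
have jP k : (k <= r)%N -> jump rho (P (r - k)%N k).
  move=> kr; have := jumpP (inord k); congr jump; apply: ext; rewrite ffunE ?eqxx ?Pi ?Pj.
    by apply: val_inj; rewrite /= !inK // ?subSS; lia.
  by rewrite eq_sym (negPf ij).
have succi x y : (x < r)%N -> (y <= r)%N -> cube_succ (P x y) i (P x.+1 y).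
  move=> xr yr k; case/orP: (Iij k) => /eqP->; rewrite ?Pi ?Pj ?eqxx ?(eq_sym j) ?(negPf ij) !inK; lia.
have succj x y : (x <= r)%N -> (y < r)%N -> cube_succ (P x y) j (P x y.+1).
  move=> xr yr k; case/orP: (Iij k) => /eqP->; rewrite ?Pi ?Pj ?eqxx ?(eq_sym j) ?(negPf ij) !inK; lia.
have anti k : (k <= r)%N -> rho (P (r - k)%N k) = 0.
  elim: k => [|k IH] kr; first by rewrite subn0 gx // subrr.
  have [_ /(_ j _ (succj _ _ _ _))] := jP k (ltnW kr).
  rewrite IH ?(ltnW kr) // => /(_ ltac:(lia) ltac:(lia)) e1.
  have [_ /(_ i _ (succi _ _ _ _))] := jP k.+1 kr.
  rewrite (_ : (r - k.+1).+1 = r - k)%N; last by lia.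
  move=> /(_ ltac:(lia) ltac:(lia)); rewrite e1; lia.
have above x y : (x <= r)%N -> (y <= r)%N -> (r < x + y)%N -> rho (P x y) = -1.
  move=> xr yr xy; have [_ /(_ i _ (succi _ _ _ _))] := jP y yr.
  move=> /(_ ltac:(lia) ltac:(lia)); rewrite anti // => e1.
  have := mono (r - y).+1 y x y ltac:(lia) ltac:(lia).
  have := rho4 (P x y); lia.
have below x y : (x + y <= r)%N -> rho (P x y) <= r%:Z - x%:Z - y%:Z.
  elim: x => [|x IH] xy; first by rewrite gy; lia.
  have := sup x (r - x)%N x.+1 y ltac:(lia) ltac:(lia).
  have := anti (r - x)%N ltac:(lia); rewrite subKn; last by lia.
  rewrite (above x.+1 (r - x)%N); [|lia..].
  have := IH ltac:(lia); lia.
move=> a; have -> : a = P (a i) (a j) by apply: ext; rewrite ?Pi ?Pj inord_val.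
move: (a i : nat) (a j : nat) (ltn_ord (a i)) (ltn_ord (a j)) => x y; rewrite !ltnS => xr yr.
have -> : standard_rank (P x y) = Num.max (-1) (r%:Z - (x + y)%N%:Z).
  rewrite /standard_rank (bigD1 i) //= (bigD1 j) /=; last by rewrite eq_sym ij.
  rewrite big1 ?addn0 => [|k]; first by rewrite Pi Pj !inK.
  by have := Iij k; case: eqP => //= _ ->.
have [xy|xy] := leqP (x + y)%N r; last by rewrite above //; lia.
have := below x y xy; have := sup 0%N y x 0%N ltac:(lia) ltac:(lia).
rewrite gx // gy // (gx 0%N) //; lia.
Qed.

End RankFunctions.

(** * Slope structures near a point *)

Section LocalStructure.
Context {R : realType} {G : graph} {ell : edge G -> R} {r : nat}.
Implicit Types (S : slope_data r ell) (a b : oarc G) (x : mpoint ell) (u : R).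

(** Slopes are read on oriented edges, so that points can be rewritten without
    transporting tangent vectors. *)
Definition point_slope S x a (i : 'I_r.+1) : int :=
  if (insub a : option (tangent x)) is Some nu then mslope S nu i else 0.

Definition arc_slopes S a u : 'I_r.+1 -> int := point_slope S (arc_pt ell a u) a.

Lemma point_slopeE S x (nu : tangent x) : point_slope S x (val nu) =1 mslope S nu.
Proof. by move=> i; rewrite /point_slope valK. Qed.

(** What is needed of a slope structure on a metric graph, freed from the model
    on which it is defined. *)
Definition local_structure S : Prop :=
  [/\ forall a u (i j : 'I_r.+1), 0 <= u < ell a.1 -> (i < j)%N -> arc_slopes S a u i < arc_slopes S a u j,
      forall x, rank_function (@mrank _ _ _ _ S x) &
      forall a u, 0 <= u < ell a.1 -> exists delta,
        [/\ 0 < delta, u + delta <= ell a.1 & forall w, u < w < u + delta ->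
          [/\ arc_slopes S a w =1 arc_slopes S a u,
              forall i, arc_slopes S (opp_arc a) (ell a.1 - w) (rev_ord i) = - arc_slopes S a u i &
              @mrank _ _ _ _ S (arc_pt ell a w) =1 standard_rank]]].

Lemma slope_structure_local S : metric_graph ell -> is_slope_structure S -> local_structure S.
Proof.
move=> ellP [H [ell' [phi [s [phiM [ind1 ind2 ind3]]]]]].
have [ellP' _ _] := phiM; have [psi [phiK psiK _]] := model_inverse phiM.
have key x y a (a' : oarc H) i : phi y = x -> a \in tan_arcs x -> a' \in tan_arcs y ->
    (exists2 delta, 0 < delta & forall h, 0 < h < delta ->
       phi (arc_pt ell' a' (arc_pos y a' + h)) = arc_pt ell a (arc_pos x a + h)) ->
    point_slope S x a i = gslope s a' i.
  move=> yx ax a'y par; subst x.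
  rewrite -[a]/(val (exist _ a ax : tangent (phi y))) point_slopeE.
  by rewrite (ind1 y (exist _ a' a'y)).
have germ x a : a \in tan_arcs x -> exists y (a' : oarc H), [/\ phi y = x, a' \in tan_arcs y &
    exists2 delta, 0 < delta & forall h, 0 < h < delta ->
       phi (arc_pt ell' a' (arc_pos y a' + h)) = arc_pt ell a (arc_pos x a + h)].
  rewrite -(psiK x); move: (psi x) => {x} y ax.
  have [theta _ thetaP] := tangent_bij ellP ellP' phiM y.
  exists y, (val (theta (exist _ a ax))); split=> //; first exact: valP.
  exact: (thetaP _ _).2 (erefl (theta (exist _ a ax))).
split=> [a u i j ua ij|x|a u ua].
- have ax := mem_tan_arc_pt (ell_gt0 ellP) ua.
  have [y [a' [yx a'y par]]] := germ _ _ ax.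
  by rewrite /arc_slopes !(key _ _ _ _ _ yx ax a'y par); apply: gslope_lt.
- have [[v vx]|/forallNP nv] := pselect (exists v, phi (vert ell' v) = x); last first.
    rewrite (_ : @mrank _ _ _ _ S x = @standard_rank _ _); first exact: standard_rank_function.
    by apply/funext => a; apply: ind3.
  subst x; have [theta thetaB thetaP] := tangent_bij ellP ellP' phiM (vert ell' v).
  have [eta thetaK etaK] := thetaB.
  rewrite (_ : @mrank _ _ _ _ S _ = @grank _ _ s v \o cube_comp eta).
    by apply: rank_function_comp; [exists theta | apply: grankP].
  apply/funext => a; apply: ind2 => nu' nu /thetaP ->.
  by rewrite ffunE thetaK.
have ax := mem_tan_arc_pt (ell_gt0 ellP) ua.
have [y [a' [yx a'y par]]] := germ _ _ ax.
have ua' i : arc_slopes S a u i = gslope s a' i by exact: key yx ax a'y par.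
have [d d0 dP] := par.
rewrite (arc_pos_arc_pt (ell_gt0 ellP) ua) in dP.
have := arc_pos_bound (ell_gt0 ellP') a'y; move: (arc_pos y a') dP => u' dP u'P.
exists (Num.min d (Num.min (ell a.1 - u) (ell' a'.1 - u'))).
have [le1 le2 le3] : [/\ Num.min d (Num.min (ell a.1 - u) (ell' a'.1 - u')) <= d,
    Num.min d (Num.min (ell a.1 - u) (ell' a'.1 - u')) <= ell a.1 - u &
    Num.min d (Num.min (ell a.1 - u) (ell' a'.1 - u')) <= ell' a'.1 - u'].
  by rewrite !ge_min !lexx !orbT.
have m0 : 0 < Num.min d (Num.min (ell a.1 - u) (ell' a'.1 - u')).
  by rewrite !lt_min d0; lra.
split=> [||w]; [by [] | by lra |].
move: (Num.min _ _) le1 le2 le3 m0 => m le1 le2 le3 m0 wm.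
have dP' k : 0 < k < d -> phi (arc_pt ell' a' (u' + k)) = arc_pt ell a (u + k) by exact: dP.
have [h [h0 hm wE]] : exists h, [/\ 0 < h, h < m & w = u + h].
  by exists (w - u); split; [lra | lra | ring].
subst w; have zx : phi (arc_pt ell' a' (u' + h)) = arc_pt ell a (u + h) by apply: dP'; lra.
have u'h : 0 < u' + h < ell' a'.1 by lra.
have uh : 0 < u + h < ell a.1 by lra.
have fwd : arc_slopes S a (u + h) =1 gslope s a'.
  move=> i; apply: (key _ _ _ _ _ zx).
  - by apply: (mem_tan_arc_pt (ell_gt0 ellP)); lra.
  - by apply: (mem_tan_arc_pt (ell_gt0 ellP')); lra.
  exists (m - h) => [|k hk]; first by lra.
  rewrite (arc_pos_arc_pt (ell_gt0 ellP)); last by lra.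
  rewrite (arc_pos_arc_pt (ell_gt0 ellP')); last by lra.
  by rewrite -!addrA; apply: dP'; lra.
have bwd : arc_slopes S (opp_arc a) (ell a.1 - (u + h)) =1 gslope s (opp_arc a').
  move=> i; rewrite /arc_slopes arc_pt_opp; apply: (key _ _ _ _ _ zx).
  - by rewrite tan_arc_pt_in // inE.
  - by rewrite tan_arc_pt_in // inE.
  exists h => // k hk; rewrite (arc_pos_opp ellP) ?(arc_pos_opp ellP') //.
  rewrite (_ : ell a.1 - (u + h) + k = ell (opp_arc a).1 - (u + (h - k))); last by rewrite /=; ring.
  rewrite (_ : ell' a'.1 - (u' + h) + k = ell' (opp_arc a').1 - (u' + (h - k))); last by rewrite /=; ring.
  by rewrite !arc_pt_opp; apply: dP'; lra.
split=> [i|i|c]; first by rewrite fwd ua'.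
  by rewrite bwd ua'; apply/eqP; rewrite -addr_eq0 addrC gslope_opp.
apply: ind3 => v; rewrite -zx => /(can_inj phiK)/(congr1 val).
by rewrite val_arc_pt.
Qed.

End LocalStructure.

(** * Slopes of an admissible semimodule along an edge *)

Section TwoPoints.
Context {R : realType} {G : graph} {ell : edge G -> R}.

Lemma two_point_divisor (x1 x2 : mpoint ell) (k1 k2 : nat) : x1 <> x2 ->
  exists E : divisor ell,
    [/\ effective E, degree E = (k1 + k2)%N%:Z, E x1 = k1%:Z & E x2 = k2%:Z].
Proof.
move=> /eqP ne.
pose E : divisor ell := [fsfun x in [fset x1; x2]%fset => if x == x1 then k1%:Z else k2%:Z].
have EE x : E x = if x \in [fset x1; x2]%fset then (if x == x1 then k1%:Z else k2%:Z) else 0.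
  by rewrite fsfunE.
exists E; split.
- by move=> x; rewrite EE; case: ifP => // _; case: ifP.
- rewrite /degree; transitivity (\sum_(x <- [fset x1; x2]%fset) E x); last first.
    by rewrite big_fsetU1 ?inE //= big_seq_fset1 !EE !inE !eqxx orbT (eq_sym x2) (negPf ne) PoszD.
  apply: big_fset_incl => [|x _]; last by rewrite mem_finsupp negbK => /eqP.
  by apply/fsubsetP => x; rewrite mem_finsupp EE; case: ifP => //; rewrite eqxx.
- by rewrite EE !inE eqxx.
- by rewrite EE !inE eqxx orbT (eq_sym x2) (negPf ne).
Qed.

End TwoPoints.

Section Admissible.
Context {R : realType} {G : graph} {ell : edge G -> R} {r : nat}.
Hypothesis ellP : metric_graph ell.
Variable D : divisor ell.
Hypothesis hD : forall x, D x <> 0 -> exists v, x = vert ell v.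
Variables (M : set (mpoint ell -> R)) (S : slope_data r ell).
Hypothesis MS : admissible D M S.
Implicit Types (a b : oarc G) (x : mpoint ell) (u : R) (i j k : 'I_r.+1).
Local Notation l0 := (ell_gt0 ellP).

Lemma admissible_local : local_structure S.
Proof. by apply: slope_structure_local => //; case: MS. Qed.

Lemma admissible_RatD f : M f -> RatD D f.
Proof. by move=> Mf; case: MS => -[_ MD] _ _ _ _; apply: MD. Qed.

Lemma slopes_at_arc f x (c : cube r (tangent x)) (nu : tangent x) : slopes_at S f c ->
  arc_slope f (val nu) (arc_pos x (val nu)) = point_slope S x (val nu) (c nu).
Proof. by move=> /(_ nu); rewrite slope_arc // point_slopeE. Qed.

Definition standard_at a u : Prop := @mrank _ _ _ _ S (arc_pt ell a u) =1 standard_rank.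

Lemma arc_slopes_le a u i j : 0 <= u < ell a.1 -> (i <= j)%N ->
  arc_slopes S a u i <= arc_slopes S a u j.
Proof.
have [Slt _ _] := admissible_local; move=> ua.
by rewrite leq_eqVlt => /orP[/eqP/val_inj->//|/(Slt _ _ _ _ ua)/ltW].
Qed.

Lemma tan_arc a u : 0 <= u < ell a.1 -> exists nu : tangent (arc_pt ell a u), val nu = a.
Proof. by move=> ua; exists (exist _ a (mem_tan_arc_pt l0 ua)). Qed.

Lemma tan_opp_arc a u : 0 < u < ell a.1 ->
  exists nu : tangent (arc_pt ell a u), val nu = opp_arc a.
Proof.
move=> ua; have aP : opp_arc a \in tan_arcs (arc_pt ell a u).
  by rewrite tan_arcs_pair // eqxx orbT.
by exists (exist _ (opp_arc a) aP).
Qed.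

(** A function of rank at least [k] at a standard point has slope index at most
    [r - k] there, in both directions.  Prescribing rank [r - i] at one point
    and [i] at a later one forces the slope to be at most the [i]-th one after
    the former and at least the [i]-th one before the latter. *)
Lemma admissible_two_points a u1 u2 i : 0 < u1 -> u1 < u2 -> u2 < ell a.1 ->
  standard_at a u1 -> standard_at a u2 -> exists2 f, M f &
    arc_slope f a u1 <= arc_slopes S a u1 i /\
    arc_slope f (opp_arc a) (ell a.1 - u2) <= arc_slopes S (opp_arc a) (ell a.1 - u2) (rev_ord i).
Proof.
move=> u10 u12 u2l st1 st2.
have u1a : 0 < u1 < ell a.1 by lra.
have u2a : 0 < u2 < ell a.1 by lra.
have [|E [E0 Edeg E1 E2]] := @two_point_divisor _ _ _ (arc_pt ell a u1) (arc_pt ell a u2) (r - i) i.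
  move=> /(congr1 (fun x => arc_pos x a)); rewrite !(arc_pos_arc_pt l0); lra.
have ir : (i <= r)%N by rewrite -ltnS.
rewrite subnK // in Edeg; have [_ _ _ _ /(_ E E0 Edeg)[f Mf fP]] := MS.
exists f => //; split.
  have [nu nuE] := tan_arc (a := a) (u := u1) ltac:(lra).
  have [[c cP]] := fP (arc_pt ell a u1); rewrite E1 st1 /standard_rank (bigD1 nu) //= => Ec _.
  have := slopes_at_arc nu cP; rewrite nuE (arc_pos_arc_pt l0) => [->|]; last by lra.
  apply: arc_slopes_le; first by lra.
  by move: (\sum_(_ | _) _)%N (c nu : nat) (i : nat) ir Ec; clear; lia.
have [nu nuE] := tan_opp_arc u2a.
have [[c cP]] := fP (arc_pt ell a u2); rewrite E2 st2 /standard_rank (bigD1 nu) //= => Ec _.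
have ci : (c nu <= rev_ord i)%N.
  by rewrite /= subSS; move: (\sum_(_ | _) _)%N (c nu : nat) (i : nat) ir Ec; clear; lia.
have := slopes_at_arc nu cP; rewrite nuE (arc_pos_opp ellP) // => ->.
by move: (c nu) ci => k ki; rewrite -arc_pt_opp; apply: arc_slopes_le => //=; lra.
Qed.

Lemma standard_mono a u1 u2 i : 0 < u1 -> u1 < u2 -> u2 < ell a.1 ->
  standard_at a u1 -> standard_at a u2 ->
  - arc_slopes S (opp_arc a) (ell a.1 - u2) (rev_ord i) <= arc_slopes S a u1 i.
Proof.
move=> u10 u12 u2l st1 st2; have [f Mf [f1 f2]] := admissible_two_points i u10 u12 u2l st1 st2.
have := RatD_slope_mono ellP hD (admissible_RatD Mf) (a := a) (ltW u10) u12 (ltW u2l).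
lia.
Qed.

Lemma next_germ a u e : 0 <= u < ell a.1 -> 0 < e -> exists w,
  [/\ u < w < u + e, w < ell a.1, arc_slopes S a w =1 arc_slopes S a u,
      forall i, arc_slopes S (opp_arc a) (ell a.1 - w) (rev_ord i) = - arc_slopes S a u i &
      standard_at a w].
Proof.
have [_ _ S3] := admissible_local; move=> ua e0; have [d [d0 dl dP]] := S3 a u ua.
have [h [h0 hd he]] : exists h, [/\ 0 < h, h < d & h < e].
  exists (Num.min d e / 2); have : 0 < Num.min d e by rewrite lt_min d0.
  have [] : Num.min d e <= d /\ Num.min d e <= e by rewrite !ge_min !lexx orbT.
  by split; lra.
by have [w1 w2 w3] := dP (u + h) ltac:(lra); exists (u + h); split=> //; lra.
Qed.

Lemma prev_germ a u e : 0 < u <= ell a.1 -> 0 < e -> exists w,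
  [/\ u - e < w < u, 0 < w,
      forall i, arc_slopes S a w i = - arc_slopes S (opp_arc a) (ell a.1 - u) (rev_ord i),
      arc_slopes S (opp_arc a) (ell a.1 - w) =1 arc_slopes S (opp_arc a) (ell a.1 - u) &
      standard_at a w].
Proof.
move=> ua e0.
have [|w [/andP[w1 w2] wl we wo wst]] := @next_germ (opp_arc a) (ell a.1 - u) e _ e0.
  by rewrite /=; lra.
rewrite /= in wl wo w1 w2; rewrite opp_arcK in wo; exists (ell a.1 - w); split.
- by lra.
- by lra.
- by move=> i; rewrite -wo rev_ordK.
- by rewrite subKr.
- by move=> c; move: c; rewrite -arc_pt_opp subKr; apply: wst.
Qed.

(** The slopes just after [u1] and just before [u2] are those at standard
    points. *)
Lemma slopes_mono a u1 u2 i : 0 <= u1 -> u1 < u2 -> u2 <= ell a.1 ->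
  - arc_slopes S (opp_arc a) (ell a.1 - u2) (rev_ord i) <= arc_slopes S a u1 i.
Proof.
move=> u10 u12 u2l.
have [||w1 [/andP[w11 w12] _ w1E _ st1]] := @next_germ a u1 ((u2 - u1) / 2); [lra|lra|].
have [||w2 [/andP[w21 w22] _ _ w2E st2]] := @prev_germ a u2 ((u2 - u1) / 2); [lra|lra|].
by rewrite -w1E -w2E; apply: standard_mono => //; lra.
Qed.

(** With both points just after [(a, u)], the inequalities given by [f] and by
    its concavity close up into equalities. *)
Lemma slopes_attained a u i : 0 <= u < ell a.1 ->
  exists f w, [/\ RatD D f, 0 <= w < ell a.1 & arc_slopes S a u i = arc_slope f a w].
Proof.
move=> ua.
have [|w2 [/andP[w21 w22] w2l _ w2E st2]] := @next_germ a u (ell a.1 - u) ua; first by lra.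
have [|w1 [/andP[w11 w12] w1l w1E _ st1]] := @next_germ a u (w2 - u) ua; first by lra.
have [|||f Mf [f1 f2]] := @admissible_two_points a w1 w2 i _ _ _ st1 st2; try lra.
exists f, w1; split; [exact: admissible_RatD | lra |].
have := RatD_slope_mono ellP hD (admissible_RatD Mf) (a := a) (u1 := w1) (u2 := w2)
  ltac:(lra) ltac:(lra) ltac:(lra).
by rewrite w1E in f1; rewrite w2E in f2; lia.
Qed.

(** The slopes towards the tail are read as slopes in the direction of [a], by a
    sign and the reversal of the indices: the slope set of [a] changes at the
    point. *)
Definition break a u : Prop :=
  exists i, arc_slopes S (opp_arc a) (ell a.1 - u) (rev_ord i) <> - arc_slopes S a u i.

Lemma not_break a u : ~ break a u ->
  forall i, arc_slopes S (opp_arc a) (ell a.1 - u) (rev_ord i) = - arc_slopes S a u i.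
Proof. by move=> nb i; apply: contrapT => ne; apply: nb; exists i. Qed.

(** Without a break, the functions above have slope index [i] on both sides of
    the point, for each [i]; compatibility makes the antidiagonal consist of
    jumps. *)
Lemma not_break_standard a u : 0 < u < ell a.1 -> ~ break a u -> standard_at a u.
Proof.
move=> ua /not_break nb; have [Slt Srk _] := admissible_local.
have [nu nuE] := tan_arc (a := a) (u := u) ltac:(lra).
have [nu' nu'E] := tan_opp_arc ua.
have ne : nu' != nu by rewrite -val_eqE nuE nu'E -pair_eqE /=; case: (a.2); rewrite ?andbF.
have two (mu : tangent (arc_pt ell a u)) : (mu == nu') || (mu == nu).
  by have := valP mu; rewrite (tan_arcs_pair _ ua) -!val_eqE nuE nu'E orbC.
apply: (rank_standard_of_antidiagonal ne two (Srk _)) => i.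
have [||w1 [/andP[w11 w12] w10 w1E _ st1]] := @prev_germ a u u; [lra|lra|].
have [||w2 [/andP[w21 w22] w2l _ w2E st2]] := @next_germ a u (ell a.1 - u); [lra|lra|].
have [|||f Mf [f1 f2]] := @admissible_two_points a w1 w2 i _ _ _ st1 st2; try lra.
have fD := admissible_RatD Mf; rewrite w1E nb opprK in f1; rewrite w2E in f2.
have m1 := RatD_slope_mono ellP hD fD (a := a) (u1 := w1) (u2 := u) ltac:(lra) ltac:(lra) ltac:(lra).
have m2 := RatD_slope_mono ellP hD fD (a := a) (u1 := u) (u2 := w2) ltac:(lra) ltac:(lra) ltac:(lra).
have m3 := RatD_opp_slope ellP hD fD ua.
have e1 : arc_slope f a u = arc_slopes S a u i by lia.
have e2 : arc_slope f (opp_arc a) (ell a.1 - u) = - arc_slopes S a u i by lia.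
have [_ _ _ MR _] := MS; have [_ /(_ (arc_pt ell a u))[_ [c cj cs]]] := MR f Mf.
suff -> : [ffun l => if l == nu' then rev_ord i else i] = c by [].
have inj b t j k : 0 <= t < ell b.1 -> arc_slopes S b t j = arc_slopes S b t k -> j = k.
  move=> tb E; apply: val_inj; have [jk|kj|//] := ltngtP j k.
    by have := Slt _ _ _ _ tb jk; rewrite E ltxx.
  by have := Slt _ _ _ _ tb kj; rewrite E ltxx.
have c1 : c nu = i.
  apply: (inj a u); first by lra.
  have := slopes_at_arc nu cs; rewrite nuE (arc_pos_arc_pt l0); last by lra.
  by rewrite e1 => ->.
have c2 : c nu' = rev_ord i.
  apply: (inj (opp_arc a) (ell a.1 - u)); first by rewrite /=; lra.
  have := slopes_at_arc nu' cs; rewrite nu'E (arc_pos_opp ellP) // nb -e2 => ->.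
  by rewrite /arc_slopes arc_pt_opp.
apply/ffunP => mu; rewrite ffunE; have := two mu; case: eqP => [->//|_ /= /eqP->].
by rewrite c1.
Qed.

(** Slopes persist to the right of every point, and where there is no break they
    agree with those just before. *)
Lemma slopes_constant a u1 u2 : 0 <= u1 -> u2 <= ell a.1 ->
  (forall u, u1 < u < u2 -> ~ break a u) ->
  forall u, u1 <= u < u2 -> arc_slopes S a u =1 arc_slopes S a u1.
Proof.
move=> u10 u2l nb v vP; have [_ _ S3] := admissible_local.
apply: (@interval_induction R u1 v (fun u => arc_slopes S a u =1 arc_slopes S a u1)) => //;
  last by lra.
- move=> u uP uE; have [|d [d0 _ dP]] := S3 a u; first by lra.
  exists d => // w wP _ i; have [-> _ _] := dP w wP; exact: uE.
- move=> u uP uE i.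
  have [||w [/andP[w1 w2] w0 wE _ _]] := @prev_germ a u (u - u1); [lra|lra|].
  rewrite -(uE w ltac:(lra)) wE not_break ?opprK //; apply: nb; lra.
Qed.

Definition slope_sum a u : int := \sum_i arc_slopes S a u i.

(** At each break some slope drops, and no slope ever increases. *)
Lemma break_drop a u v : 0 <= u -> u < v -> v < ell a.1 -> break a v ->
  slope_sum a v < slope_sum a u.
Proof.
move=> u0 uv vl [i0 ne].
have le1 i : - arc_slopes S (opp_arc a) (ell a.1 - v) (rev_ord i) <= arc_slopes S a u i.
  by apply: slopes_mono => //; lra.
have le2 i : arc_slopes S a v i <= - arc_slopes S (opp_arc a) (ell a.1 - v) (rev_ord i).
  have [||w1 [/andP[w11 w12] w10 w1E _ _]] := @prev_germ a v v; [lra|lra|].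
  have [||w2 [/andP[w21 w22] w2l _ w2E _]] := @next_germ a v (ell a.1 - v); [lra|lra|].
  have := @slopes_mono a w1 w2 i; rewrite w2E w1E opprK; apply; lra.
rewrite /slope_sum (bigD1 i0) //= [ltRHS](bigD1 i0) //=; apply: ltr_leD.
  by apply: lt_le_trans (le1 i0); rewrite lt_neqAle le2 andbT; apply/eqP => E; apply: ne; rewrite E opprK.
by apply: ler_sum => i _; apply: le_trans (le1 i).
Qed.

End Admissible.

(** * Subdivisions *)

Section Routes.
Context {R : realType} {G : graph} {ell : edge G -> R}.
Implicit Types x y z : mpoint ell.

Lemma route_trans x y z L K : route x y L -> route y z K -> route x z (L + K).
Proof.
move=> xy; elim=> [|e s t K' se te _ IH]; first by rewrite addr0.
by rewrite addrA; apply: route_step.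
Qed.

Lemma route_pt e s t : 0 <= s <= ell e -> 0 <= t <= ell e ->
  route (pt ell e s) (pt ell e t) `|t - s|.
Proof.
by move=> se te; rewrite -[X in route _ _ X]add0r; apply: route_step => //; apply: route_nil.
Qed.

Lemma route_sym x y L : route x y L -> route y x L.
Proof.
elim=> [|e s t K se te _ IH]; first exact: route_nil.
by rewrite addrC; apply: route_trans IH; rewrite distrC; apply: route_pt.
Qed.

End Routes.

Section PathVertices.
Context {G : graph} (n : edge G -> nat).
Implicit Types (e : edge G) (k : nat).
Local Arguments path_vertex : simpl never.

Lemma path_vertex_inner e k (kn : (k < n e)%N) :
  path_vertex n e k.+1 = inr (existT (fun e => 'I_(n e)) e (Ordinal kn)).
Proof. by rewrite /path_vertex insubT. Qed.

Lemma path_vertex_last e : path_vertex n e (n e).+1 = inl (ends e true).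
Proof. by rewrite /path_vertex insubF ?ltnn. Qed.

Lemma path_vertex_inj e e' k k' : (0 < k <= n e)%N ->
  path_vertex n e k = path_vertex n e' k' -> (e, k) = (e', k').
Proof.
case: k => // k kn; rewrite (@path_vertex_inner e k kn); case: k' => // k'.
rewrite /path_vertex; case: insubP => // i _ <-.
pose code (v : sub_vertex n) := if v is inr u then (tag u, (tagged u : nat)) else (e, 0%N).
by move=> /(congr1 code) [-> ->].
Qed.

Lemma path_vertex_neq e k : (0 < n e)%N -> (k <= n e)%N ->
  path_vertex n e k <> path_vertex n e k.+1.
Proof.
move=> n0 kn; have [k0|k0] := posnP k.
  by rewrite k0 (path_vertex_inner n0).
by move=> /(path_vertex_inj (e := e)); rewrite k0 kn => /(_ isT) [] /n_Sn.
Qed.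

(** One end of each piece is an inner vertex, which determines the path and the
    position on it.  Two inner vertices are needed on each path, as the other
    end may be shared by its first and last pieces. *)
Lemma subdivision_simple : (forall e, (1 < n e)%N) -> simple_graph (subdivision n).
Proof.
move=> n2; have kn (ek : edge (subdivision n)) : (tagged ek <= n (tag ek))%N.
  by rewrite -ltnS; exact: ltn_ord.
split=> [[ek b]|[ek b] [ek' b']]; rewrite /arc_tail /arc_head /=.
  have ne := path_vertex_neq (ltnW (n2 (tag ek))) (kn ek).
  by case: b; rewrite /= ?addn0 ?addn1 // => /esym.
have := kn ek; have := kn ek'; have := n2 (tag ek); have := n2 (tag ek').
case: ek ek' => [e k] [e' k'] /= ne' ne ke' ke t h.
suff [ee kk] : e = e' /\ (k = k' :> nat) by subst e'; congr existT; apply: val_inj.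
have [tk|tk] := boolP (0 < k + b <= n e)%N.
  have [ee kk] := path_vertex_inj tk t; subst e'; split=> //.
  have [hk|hk] := boolP (0 < k + ~~ b <= n e)%N; first by have [] := path_vertex_inj hk h; lia.
  have [hk'|hk'] := boolP (0 < k' + ~~ b' <= n e)%N; first by have [] := path_vertex_inj hk' (esym h); lia.
  case: b b' tk hk hk' kk {t h} => [] [] /=; lia.
have hk : (0 < k + ~~ b <= n e)%N by case: b tk {t h} => /=; lia.
have [ee kk] := path_vertex_inj hk h; subst e'; split=> //.
have [tk'|tk'] := boolP (0 < k' + b' <= n e)%N; first by have [] := path_vertex_inj tk' (esym t); lia.
case: b b' tk hk tk' kk {t h} => [] [] /=; lia.
Qed.

Lemma adjacent_sym (H : graph) : symmetric (@adjacent H).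
Proof.
move=> u v; apply/existsP/existsP => -[a /andP[/eqP au /eqP av]]; exists (opp_arc a);
  by rewrite /arc_tail /arc_head /= ?negbK -au -av /arc_tail /arc_head /= !eqxx.
Qed.

Lemma subdivision_connected : connected_graph G -> connected_graph (subdivision n).
Proof.
move=> Gconn; have csym := sym_connect_sym (@adjacent_sym (subdivision n)).
have step e k : (k <= (n e).+1)%N -> connect (@adjacent (subdivision n)) (inl (ends e false)) (path_vertex n e k).
  elim: k => [|k IH] kn; first exact: connect0.
  apply: connect_trans (IH (ltnW kn)) _; apply: connect1; apply/existsP.
  exists ((existT _ e (Ordinal kn) : edge (subdivision n)), false).
  by rewrite /arc_tail /arc_head /= addn0 addn1 !eqxx.
have old v w : connect (@adjacent (subdivision n)) (inl v) (inl w).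
  move: (Gconn v w) => /connectP[p pP ->]; elim: p v pP => [|u p IH] v /=.
    by move=> _; apply: connect0.
  move=> /andP[/existsP[[e b] /andP[/eqP <- /eqP <-]] pP]; apply: connect_trans (IH _ pP).
  have := step e (n e).+1 (leqnn _); rewrite path_vertex_last => ee.
  by case: b {pP}; rewrite /arc_tail /arc_head //= csym.
have toold u : exists v, connect (@adjacent (subdivision n)) (inl v) u.
  case: u => [v|[e k]]; first by exists v; apply: connect0.
  exists (ends e false); have := step e k.+1 (leqW (ltn_ord k)).
  by rewrite (path_vertex_inner (ltn_ord k)) (_ : Ordinal _ = k) //; apply: val_inj.
move=> u w; have [v vu] := toold u; have [v' vw] := toold w.
by apply: connect_trans (connect_trans (old v v') vw); rewrite csym.
Qed.

End PathVertices.

Section Placement.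
Context {R : realType} {G : graph} (ell : edge G -> R).
Hypothesis ellP : metric_graph ell.
Context (n : edge G -> nat) (p : edge G -> nat -> R).
Hypothesis pP : placement n ell p.
Local Notation len := (sub_length (n := n) p).
Local Notation pl := (place (n := n) ell p).
Local Arguments path_vertex : simpl never.
Implicit Types (e : edge G) (k : nat).

Definition sub_edge_at e k : edge (subdivision n) := existT _ e (inord k).

Lemma sub_edge_bound (ek : edge (subdivision n)) : (tagged ek <= n (tag ek))%N.
Proof. by rewrite -ltnS; exact: ltn_ord. Qed.

Lemma sub_length_at e k : (k <= n e)%N -> len (sub_edge_at e k) = p e k.+1 - p e k.
Proof. by move=> kn; rewrite /sub_length /= inordK. Qed.

Lemma placement_lt e j k : (j < k)%N -> (k <= (n e).+1)%N -> p e j < p e k.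
Proof.
have [_ _ lt] := pP e; elim: k => // k IH; rewrite ltnS leq_eqVlt => /orP[/eqP-> |jk] kn.
  exact: lt.
by apply: lt_trans (IH jk (ltnW kn)) (lt _ kn).
Qed.

Lemma placement_le e j k : (j <= k)%N -> (k <= (n e).+1)%N -> p e j <= p e k.
Proof. by rewrite leq_eqVlt => /orP[/eqP->//|jk kn]; apply/ltW/placement_lt. Qed.

Lemma placement_bound e k : (k <= (n e).+1)%N -> 0 <= p e k <= ell e.
Proof.
by move=> kn; have [p0 pl _] := pP e; rewrite -[X in X <= p e k]p0 -pl !placement_le.
Qed.

Lemma sub_metric_graph : metric_graph len.
Proof.
have [Gconn /card_gt0P[e _] _] := ellP; split.
- exact: subdivision_connected.
- by apply/card_gt0P; exists (sub_edge_at e 0).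
- move=> ek; rewrite /sub_length subr_gt0; have [_ _] := pP (tag ek); apply.
  exact: sub_edge_bound.
Qed.

Lemma place_vertex e k : (k <= (n e).+1)%N -> pl (vert len (path_vertex n e k)) = pt ell e (p e k).
Proof.
have [p0 pe _] := pP e; case: k => [_|k]; first by rewrite p0 pt0.
rewrite leq_eqVlt => /orP[/eqP ->|kn].
  by rewrite path_vertex_last pe (pt_ell (ell_gt0 ellP)).
by rewrite (@path_vertex_inner G n e k kn).
Qed.

Lemma place_pt (ek : edge (subdivision n)) s : 0 <= s <= len ek ->
  pl (pt len ek s) = pt ell (tag ek) (p (tag ek) (tagged ek) + s).
Proof.
have kn := sub_edge_bound ek; have l0 := ell_gt0 sub_metric_graph.
rewrite le_eqVlt => /andP[/orP[/eqP<- _|s0]].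
  by rewrite pt0 /= place_vertex addn0 ?addr0 // leqW.
rewrite le_eqVlt => /orP[/eqP->|sl]; last by rewrite /place val_pt ?s0.
by rewrite (pt_ell l0) /= place_vertex addn1 // /sub_length addrC subrK.
Qed.

(** The oriented edge containing a piece, and the parameter on it of the tail
    of that piece. *)
Definition whole_arc (a : oarc (subdivision n)) : oarc G := (tag a.1, a.2).
Definition piece_start (a : oarc (subdivision n)) : R :=
  arc_coord ell (whole_arc a) (p (tag a.1) (tagged a.1 + a.2)).

Lemma place_arc_pt a w : 0 <= w <= len a.1 ->
  pl (arc_pt len a w) = arc_pt ell (whole_arc a) (piece_start a + w).
Proof.
move=> wa; rewrite !arc_pt_coord place_pt; last exact: arc_coord_cc.
rewrite /arc_coord /piece_start /whole_arc /arc_coord /=; case: a wa => ek [] /= _; congr pt.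
  by rewrite /sub_length addn1; ring.
by rewrite addn0.
Qed.

Lemma place_inj : injective pl.
Proof.
have inner ek t : 0 < t < len ek -> 0 < p (tag ek) (tagged ek) + t < ell (tag ek) /\
    p (tag ek) (tagged ek) < p (tag ek) (tagged ek) + t < p (tag ek) (tagged ek).+1.
  have kn := sub_edge_bound ek; have := @placement_bound (tag ek) (tagged ek).+1 kn; have := placement_bound (leqW kn).
  by rewrite /sub_length; lra.
have vinner (u : {e & 'I_(n e)}) : 0 < p (tag u) (tagged u).+1 < ell (tag u).
  have [p0 pe _] := pP (tag u); have un := ltn_ord (tagged u).
  have := @placement_lt (tag u) (tagged u).+1 (n (tag u)).+1 un (leqnn _).
  by have := @placement_lt (tag u) 0 (tagged u).+1 (ltn0Sn _) (leqW un); rewrite p0 pe => ->.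
have ov (u : {e & 'I_(n e)}) (ek : edge (subdivision n)) t : 0 < t < len ek -> tag u = tag ek ->
    p (tag u) (tagged u).+1 <> p (tag ek) (tagged ek) + t.
  move=> /inner[_]; case: u ek t => e i [e' k] t /= tk ee; subst e' => E.
  have [ik|ki] := leqP i.+1 k.
    have := placement_le ik (leqW (leq_ord k)); lra.
  have := @placement_le e k.+1 i.+1 ki ltac:(rewrite ltnS ltnW //); lra.
have valE y : val (pl y) = match val y with
    | inl (inl v) => inl v
    | inl (inr u) => inr (tag u, p (tag u) (tagged u).+1)
    | inr (ek, t) => inr (tag ek, p (tag ek) (tagged ek) + t) end.
  case: y => -[[v|u]|[ek t]] yP; rewrite /place /= ?val_pt ?vinner //.
  by case: (inner _ _ yP).
move=> y y' /(congr1 val); rewrite !valE => E; apply: val_inj; move: E (valP y) (valP y').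
case: (val y) (val y') => [[v|u]|[ek t]] [[v'|u']|[ek' t']] //= [].
- by move=> ->.
- case: u u' => [e i] [e' i'] /= ee; subst e' => E _ _; congr (inl (inr (existT _ e _))).
  apply: val_inj => /=; have [ii|ii|//] := ltngtP i i'.
    by have := @placement_lt e i.+1 i'.+1 ii (leqW (ltn_ord i')); rewrite E ltxx.
  by have := @placement_lt e i'.+1 i.+1 ii (leqW (ltn_ord i)); rewrite E ltxx.
- by move=> ee E _ tk; case: (ov _ _ _ tk ee E).
- by move=> ee E tk _; case: (ov _ _ _ tk (esym ee) (esym E)).
- move=> ee E /inner[_ tk] /inner[_ tk'].
  case: ek ek' ee t t' E tk tk' => [e k] [e' k'] /= ee t t' E tk tk'; subst e'.
  suff kk : k = k' by subst k'; congr (inr (_, _)); lra.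
  apply: val_inj => /=; have [ii|ii|//] := ltngtP k k'.
    by exfalso; have := @placement_le e k.+1 k' ii (leqW (leq_ord k')); lra.
  by exfalso; have := @placement_le e k'.+1 k ii (leqW (leq_ord k)); lra.
Qed.

Lemma place_pt_at e k t : (k <= n e)%N -> p e k <= t <= p e k.+1 ->
  pl (pt len (sub_edge_at e k) (t - p e k)) = pt ell e t.
Proof.
move=> kn tk; rewrite place_pt ?sub_length_at //=; last by lra.
by rewrite inordK // addrC subrK.
Qed.

Lemma piece_index e t : 0 <= t <= ell e -> exists2 k, (k <= n e)%N & p e k <= t <= p e k.+1.
Proof.
have [p0 pe lt] := pP e; move=> /andP[t0]; rewrite -pe le_eqVlt => /orP[/eqP->|tl].
  by exists (n e) => //; rewrite lexx ltW ?lt.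
by have [k kn kP] := @step_index R (p e) (n e).+1 t ltac:(lra) tl; exists k => //; lra.
Qed.

Lemma place_surj x : exists y, pl y = x.
Proof.
case: x => -[v|[e t]] xP; first by exists (vert len (inl v)); apply: val_inj.
have te := xP; rewrite /is_point in te.
have [k kn kP] := @piece_index e t ltac:(lra).
exists (pt len (sub_edge_at e k) (t - p e k)); rewrite place_pt_at //.
by apply: val_inj; rewrite val_pt.
Qed.

Lemma place_route x y L : route x y L -> route (pl x) (pl y) L.
Proof.
elim=> [|ek s t K se te _ IH]; first exact: route_nil.
rewrite !place_pt // in IH *.
have kn := sub_edge_bound ek; have := @placement_bound (tag ek) (tagged ek).+1 kn.
have := placement_bound (leqW kn) => b1 b2.
rewrite (_ : t - s = p (tag ek) (tagged ek) + t - (p (tag ek) (tagged ek) + s)); last ring.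
rewrite /sub_length in se te; by apply: route_step IH; lra.
Qed.

(** A segment of an edge is cut at the subdivision vertices it contains. *)
Lemma route_pieces e k j s t : (k + j <= n e)%N ->
  p e k <= s <= p e k.+1 -> p e (k + j) <= t <= p e (k + j).+1 -> s <= t ->
  route (pt len (sub_edge_at e k) (s - p e k)) (pt len (sub_edge_at e (k + j)) (t - p e (k + j))) (t - s).
Proof.
have [_ _ lt] := pP e; elim: j t => [|j IH] t kn sk tk st.
  rewrite addn0 in tk kn *.
  rewrite -[X in route _ _ X]ger0_norm ?subr_ge0 //.
  rewrite (_ : t - s = (t - p e k) - (s - p e k)); last ring.
  by apply: route_pt; rewrite sub_length_at //; lra.
rewrite addnS in kn tk *; have kj := ltnW kn.
have s1 : s <= p e (k + j).+1.
  by have := @placement_le e k.+1 (k + j).+1 ltac:(lia) ltac:(lia); lra.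
have := IH (p e (k + j).+1) kj sk; rewrite lexx ltW ?lt // => /(_ isT s1) r1.
rewrite -(sub_length_at kj) (pt_ell (ell_gt0 sub_metric_graph)) in r1.
have vE : vert len (ends (sub_edge_at e (k + j)) true) = pt len (sub_edge_at e (k + j).+1) 0.
  by rewrite pt0 /= !inordK ?addn0 ?addn1 //; lia.
rewrite {}vE in r1; have r2 : route (pt len (sub_edge_at e (k + j).+1) 0)
   (pt len (sub_edge_at e (k + j).+1) (t - p e (k + j).+1)) `|t - p e (k + j).+1 - 0|.
  by have := lt _ kn => ltk; apply: route_pt; rewrite sub_length_at //; lra.
rewrite (_ : t - s = (p e (k + j).+1 - s) + (t - p e (k + j).+1)); last ring.
by apply: route_trans r1 _; rewrite subr0 ger0_norm in r2; [exact: r2 | lra].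
Qed.

Lemma place_route_inv x y L : route (pl x) (pl y) L -> route x y L.
Proof.
have seg e s t y1 y2 : 0 <= s <= ell e -> 0 <= t <= ell e -> s <= t ->
    pl y1 = pt ell e s -> pl y2 = pt ell e t -> route y1 y2 `|t - s|.
  move=> se te st; have [k kn kP] := piece_index se; have [k' kn' kP'] := piece_index te.
  have [[j k'E]|kk] : (exists j, k' = k + j)%N \/ (k' < k)%N.
  - by have [kk|] := leqP k k'; [left; exists (k' - k)%N; rewrite subnKC | right].
  - subst k'; rewrite -(place_pt_at kn kP) -(place_pt_at kn' kP') => /place_inj -> /place_inj ->.
    by rewrite ger0_norm ?subr_ge0 //; apply: route_pieces.
  - have := @placement_le e k'.+1 k kk (leqW kn) => le1.
    have -> : t = s by lra.
    by move=> E1 E2; rewrite (place_inj (etrans E1 (esym E2))) subrr normr0; apply: route_nil.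
suff lift y' : route (pl x) y' L -> forall y, pl y = y' -> route x y L.
  by move=> /lift; apply.
clear y; elim=> [|e s t K se te _ IH] y.
  by move=> /place_inj ->; apply: route_nil.
move=> yE; have [y1 y1E] := place_surj (pt ell e s).
apply: route_trans (IH _ y1E) _; have [st|ts] := leP s t; first exact: seg y1E yE.
by rewrite distrC; apply: route_sym; apply: seg yE y1E => //; rewrite ltW.
Qed.

(** Routes correspond to routes of the same length, so that distances are infima
    of the same sets. *)
Lemma place_model : model pl.
Proof.
split; first exact: sub_metric_graph.
- have [psi psiP] := choice place_surj; exists psi => // x; exact: place_inj.
- move=> x y; rewrite /dist; congr inf; apply/seteqP; split=> L /=.
    exact: place_route_inv.
  exact: place_route.
Qed.

End Placement.

(** * Finitely many combinatorial types *)

Section Finiteness.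
Variables (r : nat) (H : graph).

Lemma slope_structure_eq (s s' : slope_structure r H) :
  (forall a i, gslope s a i = gslope s' a i) ->
  (forall v c, @grank _ _ s v c = @grank _ _ s' v c) -> s = s'.
Proof.
case: s s' => g k p1 p2 p3 p4 [g' k' q1 q2 q3 q4] /= gE kE.
have ? : g = g' by apply/funext => a; apply/funext.
have ? : k = k' by apply: functional_extensionality_dep => v; apply/funext.
by subst g' k'; congr SlopeStructure; apply: Prop_irrelevance.
Qed.

Definition slopes_bounded (B : nat) (s : slope_structure r H) : Prop :=
  forall a i, `|gslope s a i| <= B%:Z.

Lemma finitely_many_bounded_structures (B : nat) :
  exists (k : nat) (SS : 'I_k -> slope_structure r H),
    forall s, slopes_bounded B s -> exists j, SS j = s.
Proof.
pose T : finType := ({ffun oarc H * 'I_r.+1 -> 'I_(B + B).+1} *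
  {ffun {v : vertex H & cube r {a : oarc H | a \in out_arcs v}} -> 'I_r.+2})%type.
(* shifting by [B] and by [1] makes slopes and ranks nonnegative *)
pose code (s : slope_structure r H) : T :=
  ([ffun ai => inord (absz (gslope s ai.1 ai.2 + B%:Z))],
   [ffun vc => inord (absz (@grank _ _ s (tag vc) (tagged vc) + 1))]).
have code_inj s s' : slopes_bounded B s -> slopes_bounded B s' -> code s = code s' -> s = s'.
  move=> sB s'B [/ffunP gE /ffunP kE]; apply: slope_structure_eq => [a i|v c].
    have := congr1 val (gE (a, i)); rewrite !ffunE /= !inordK; have := sB a i; have := s'B a i; lia.
  have := congr1 val (kE (existT _ v c)); rewrite !ffunE /=.
  have [_ _ _ /(_ c)] := grankP s v; have [_ _ _ /(_ c)] := grankP s' v.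
  by move=> b1 b2; rewrite !inordK; lia.
pose P : pred T := fun c => `[< exists2 s, slopes_bounded B s & code s = c >].
have /(@choice _ _ _) [SS SSP] (j : 'I_#|P|) : exists s, slopes_bounded B s /\ code s = enum_val j.
  by have /asboolP[s sB sE] := enum_valP j; exists s.
exists #|P|, SS => s sB; have Ps : code s \in P by apply/asboolP; exists s.
exists (enum_rank_in Ps (code s)); have [jB jE] := SSP (enum_rank_in Ps (code s)).
by apply: code_inj => //; rewrite jE enum_rankK_in.
Qed.

End Finiteness.

(** * Positions of the subdivision vertices *)

Section Positions.
Context {R : realType}.
Implicit Types (s : seq R) (l : R).

Lemma int_separated_seq (J : set R) (W : R -> int) (K : nat) :
  (forall u, J u -> `|W u| <= K%:Z) ->
  (forall u v, J u -> J v -> W u = W v -> u = v) ->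
  exists s, [/\ (size s <= (K + K).+1)%N, uniq s & forall u, u \in s <-> J u].
Proof.
move=> WK Winj.
pose pick k := xget 0 [set u | J u /\ W u = k%:Z - K%:Z].
have pickE u : J u -> pick (absz (W u + K%:Z)) = u.
  move=> Ju; have := WK u Ju => Wu; apply: xget_subset1 => /=; first by split=> //; lia.
  by move=> v w [Jv Ev] [Jw Ew]; apply: Winj => //; rewrite Ev Ew.
exists (undup [seq u <- [seq pick k | k <- iota 0 (K + K).+1] | `[< J u >]]); split.
- apply: leq_trans (size_undup _) _; rewrite size_filter; apply: leq_trans (count_size _ _) _.
  by rewrite size_map size_iota.
- exact: undup_uniq.
- move=> u; rewrite mem_undup mem_filter; split=> [/andP[/asboolP]//|Ju].
  apply/andP; split; first exact/asboolP.
  rewrite -{1}(pickE u Ju) map_f // mem_iota; have := WK u Ju; lia.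
Qed.

(** Padding gives all edges the same number of subdivision points. *)
Lemma pad_points s l N : 0 < l -> uniq s -> (forall x, x \in s -> 0 < x < l) ->
  (size s <= N)%N ->
  exists s', [/\ uniq s', size s' = N, (forall x, x \in s' -> 0 < x < l) & {subset s <= s'}].
Proof.
move=> l0; move Ed : (N - size s)%N => d; elim: d s Ed => [|d IH] s Ed us sl sN.
  by exists s; split=> //; lia.
have [y y0 ys] : exists2 y, 0 < y < l & forall x, x \in s -> y < x.
  elim: s {Ed us sN} sl => [|x s IHs] sl; first by exists (l / 2) => //; lra.
  have [|y y0 yP] := IHs; first by move=> z zs; apply: sl; rewrite inE zs orbT.
  have := sl x (mem_head _ _) => x0; have m0 : 0 < Num.min x y by rewrite lt_min; lra.
  have [m1 m2] : Num.min x y <= x /\ Num.min x y <= y by rewrite !ge_min !lexx orbT.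
  exists (Num.min x y / 2) => [|z]; first by lra.
  by rewrite inE => /orP[/eqP->|/yP]; lra.
have [||z||s' [us' s'N s'l ss']] := IH (y :: s).
- by rewrite /= subnS Ed.
- by rewrite /= us andbT; apply/negP => /ys; rewrite ltxx.
- by rewrite inE => /orP[/eqP->|/sl].
- by rewrite /=; lia.
by exists s'; split=> // x xs; apply: ss'; rewrite inE xs orbT.
Qed.

Lemma increasing_enumeration s l N : 0 < l -> uniq s -> size s = N ->
  (forall x, x \in s -> 0 < x < l) ->
  exists p : nat -> R, [/\ p 0%N = 0, p N.+1 = l,
    forall k, (k <= N)%N -> p k < p k.+1 &
    forall x, x \in s -> exists2 k, (k <= N)%N & p k = x].
Proof.
move=> l0 us sN sl; pose t := sort <=%O s.
have tN : size t = N by rewrite size_sort.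
have tl k : (k < N)%N -> 0 < nth 0 t k < l.
  by move=> kN; apply: sl; rewrite -(mem_sort <=%O) mem_nth ?tN.
have tlt k : (k.+1 < N)%N -> nth 0 t k < nth 0 t k.+1.
  move=> kN; have : sorted <%O t by rewrite sort_lt_sorted.
  by move=> /(sortedP 0); apply; rewrite tN.
exists (fun k => if k is k'.+1 then if (k' < N)%N then nth 0 t k' else l else 0); split=> //.
- by rewrite ltnn.
- case=> [_|k kN]; first by case: ifP => // /tl/andP[].
  by rewrite kN; case: ifP => [/tlt//|_]; case/andP: (tl k kN).
- move=> x; rewrite -(mem_sort <=%O) => /(nthP 0)[k]; rewrite -/t tN => kN kx.
  by exists k.+1 => //; rewrite kN.
Qed.

End Positions.

(** * Slope structures of admissible semimodules *)

Section AdmissibleStructure.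
Context {R : realType} {G : graph} {ell : edge G -> R} {r : nat}.
Hypothesis ellP : metric_graph ell.
Variable D : divisor ell.
Hypothesis hD : forall x, D x <> 0 -> exists v, x = vert ell v.
Variables (M : set (mpoint ell -> R)) (S : slope_data r ell).
Hypothesis MS : admissible D M S.
Variable B : nat.
Hypothesis BP : forall f a u, RatD D f -> 0 <= u < ell a.1 -> `|arc_slope f a u| <= B%:Z.
Implicit Types (a : oarc G) (u t : R).

Lemma slopes_bound a u i : 0 <= u < ell a.1 -> `|arc_slopes S a u i| <= B%:Z.
Proof. by move=> ua; have [f [w [fD wa ->]]] := slopes_attained ellP hD MS i ua; apply: BP. Qed.

Lemma break_opp a u : break S (opp_arc a) (ell a.1 - u) -> break S a u.
Proof.
move=> [i]; rewrite opp_arcK subKr => ne; exists (rev_ord i).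
by rewrite rev_ordK => E; apply: ne; rewrite E opprK.
Qed.

(** The sum of the slopes takes distinct values at the breaks of an edge. *)
Lemma placement_through_breaks N : ((r.+1 * B + r.+1 * B).+1 <= N)%N ->
  exists p, placement (fun _ => N) ell p /\
    forall e t, 0 < t < ell e -> break S (e, false) t -> exists2 k, (k <= N)%N & p e k = t.
Proof.
move=> NB; suff /choice[p pP] e : exists q : nat -> R, [/\ q 0%N = 0, q N.+1 = ell e,
    forall k, (k <= N)%N -> q k < q k.+1 &
    forall t, 0 < t < ell e -> break S (e, false) t -> exists2 k, (k <= N)%N & q k = t].
  by exists p; split=> e; have [p0 pe plt pbr] := pP e.
have [|u v [uE ub] [vE vb] WE|s [sN us sJ]] := @int_separated_seq R
    [set t | 0 < t < ell e /\ break S (e, false) t] (slope_sum S (e, false)) (r.+1 * B)%N.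
- move=> u [ue _]; apply: (le_trans (ler_norm_sum _ _ _)).
  rewrite (_ : (r.+1 * B)%N%:Z = \sum_(i : 'I_r.+1) B%:Z); last first.
    by rewrite sumr_const card_ord -mulr_natl natz -PoszM.
  by apply: ler_sum => i _; apply: slopes_bound; rewrite /=; lra.
- have drop := @break_drop R G ell r ellP D hD M S MS (e, false).
  have [uv|vu|//] := ltgtP u v.
    by have := drop u v _ uv _ vb; rewrite WE ltxx => H; exfalso; apply/notF/H => /=; lra.
  by have := drop v u _ vu _ ub; rewrite WE ltxx => H; exfalso; apply/notF/H => /=; lra.
have l0 := ell_gt0 ellP e.
have sl x : x \in s -> 0 < x < ell e by move=> /sJ[].
have [s' [us' s'N s'l ss']] := pad_points l0 us sl (leq_trans sN NB).
have [q [q0 ql qlt qs]] := increasing_enumeration l0 us' s'N s'l.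
by exists q; split=> // t te tb; apply/qs/ss'/sJ.
Qed.

Variable n : edge G -> nat.
Hypothesis n2 : forall e, (1 < n e)%N.
Variable p : edge G -> nat -> R.
Hypothesis pP : placement n ell p.
Hypothesis pbreak : forall e t, 0 < t < ell e -> break S (e, false) t ->
  exists2 k, (k <= n e)%N & p e k = t.
Local Notation len := (sub_length (n := n) p).
Local Notation pl := (place (n := n) ell p).

Lemma piece_in (a : oarc (subdivision n)) :
  [/\ 0 <= piece_start ell p a, 0 < len a.1 & piece_start ell p a + len a.1 <= ell (tag a.1)].
Proof.
have kn := sub_edge_bound a.1; have l0 := ell_gt0 (sub_metric_graph ellP pP) a.1.
have := @placement_bound R G ell n p pP (tag a.1) (tagged a.1).+1 kn.
have := placement_bound pP (leqW kn); move: l0.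
rewrite /piece_start /arc_coord /sub_length /=.
by case: a.2; rewrite /= ?addn0 ?addn1 => *; split; lra.
Qed.

Lemma no_break_in_piece (a : oarc (subdivision n)) u :
  piece_start ell p a < u < piece_start ell p a + len a.1 -> ~ break S (whole_arc a) u.
Proof.
have [q0 l0 ql] := piece_in a; have kn := sub_edge_bound a.1.
have main t : p (tag a.1) (tagged a.1) < t < p (tag a.1) (tagged a.1).+1 ->
    ~ break S (tag a.1, false) t.
  move=> tk tb.
  have := placement_bound pP (leqW kn).
  have := @placement_bound R G ell n p pP (tag a.1) (tagged a.1).+1 kn => b1 b2.
  have [|j jn jE] := pbreak _ tb; first by lra.
  have [jk|kj] := leqP j (tagged a.1).
    by have := placement_le pP jk (leqW kn); lra.
  by have := placement_le pP kj (leqW jn); lra.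
move: main; rewrite /piece_start /arc_coord /sub_length /whole_arc.
case: a.2 => /=; rewrite ?addn0 ?addn1 => main uq; last by apply: main; lra.
have := main (ell (tag a.1) - u) ltac:(lra) => nb ub; apply: nb.
by apply: (@break_opp (tag a.1, false)); rewrite subKr.
Qed.

Lemma slopes_on_piece (a : oarc (subdivision n)) w : 0 <= w < len a.1 ->
  arc_slopes S (whole_arc a) (piece_start ell p a + w) =1
  arc_slopes S (whole_arc a) (piece_start ell p a).
Proof.
have [q0 l0 ql] := piece_in a => wa.
apply: (slopes_constant ellP MS (u2 := piece_start ell p a + len a.1)) => //.
  by move=> u; apply: no_break_in_piece.
by lra.
Qed.

Lemma piece_start_opp (a : oarc (subdivision n)) :
  piece_start ell p (opp_arc a) = ell (tag a.1) - (piece_start ell p a + len a.1).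
Proof.
rewrite /piece_start /arc_coord /sub_length /=; case: a => ek [] /=; rewrite ?addn0 ?addn1; ring.
Qed.

Lemma piece_slopes_opp (a : oarc (subdivision n)) (i : 'I_r.+1) :
  arc_slopes S (whole_arc a) (piece_start ell p a) i +
  arc_slopes S (whole_arc (opp_arc a)) (piece_start ell p (opp_arc a)) (rev_ord i) = 0.
Proof.
have [q0 l0 ql] := piece_in a.
rewrite -(slopes_on_piece (a := a) (w := len a.1 / 2)); last by lra.
rewrite -(slopes_on_piece (a := opp_arc a) (w := len a.1 / 2)); last by rewrite /=; lra.
rewrite piece_start_opp (_ : _ - _ + _ = ell (tag a.1) - (piece_start ell p a + len a.1 / 2)); last by field.
have nb := @no_break_in_piece a (piece_start ell p a + len a.1 / 2) ltac:(lra).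
by have := not_break nb i; rewrite /whole_arc /= => ->; rewrite subrr.
Qed.

(** Slopes are read at the tails of the pieces, where no break interferes before
    the head; rank functions are transported along the differential of
    [place]. *)
Lemma structure_on_subdivision : exists s : slope_structure r (subdivision n),
  slopes_bounded B s /\ defined_on pl s S.
Proof.
have [Slt Srk _] := admissible_local ellP MS.
have plM := place_model ellP pP; have ellP' := sub_metric_graph ellP pP.
have theta_ex (v : vertex (subdivision n)) :
    exists theta : tangent (pl (vert len v)) -> tangent (vert len v),
      bijective theta /\ forall nu' nu, parallel nu' nu <-> nu' = theta nu.
  by have [theta thetaB thetaE] := tangent_bij ellP ellP' plM (vert len v); exists theta.
pose theta v := sval (cid (theta_ex v)); have thetaP v := svalP (cid (theta_ex v)).
have lt (a : oarc (subdivision n)) (i j : 'I_r.+1) : (i < j)%N ->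
    arc_slopes S (whole_arc a) (piece_start ell p a) i < arc_slopes S (whole_arc a) (piece_start ell p a) j.
  by move=> ij; apply: Slt => //; have := piece_in a; case=> *; rewrite /=; lra.
have rk (v : vertex (subdivision n)) : rank_function (@mrank _ _ _ _ S (pl (vert len v)) \o cube_comp (theta v)).
  by apply: rank_function_comp (Srk _); case: (thetaP v).
pose s : slope_structure r (subdivision n) := @SlopeStructure r (subdivision n)
  (fun a : oarc (subdivision n) => arc_slopes S (whole_arc a) (piece_start ell p a))
  (fun v => @mrank _ _ _ _ S (pl (vert len v)) \o cube_comp (theta v))
  (subdivision_simple n2) lt piece_slopes_opp rk.
exists s; split.
  by move=> a i; apply: slopes_bound; have := piece_in a; case=> *; rewrite /=; lra.
split; first exact: plM.
split=> [y nu' nu [delta d0 dP] i|v a b ab|x xv].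
- have a'y := valP nu'; have [q0 l0 ql] := piece_in (val nu').
  have wP := arc_pos_bound (ell_gt0 ellP') a'y.
  have yE := arc_ptK (ell_gt0 ellP') a'y.
  have plE : pl y = arc_pt ell (whole_arc (val nu')) (piece_start ell p (val nu') + arc_pos y (val nu')).
    by rewrite -[in LHS]yE place_arc_pt //; lra.
  have uP : 0 <= piece_start ell p (val nu') + arc_pos y (val nu') < ell (whole_arc (val nu')).1.
    by rewrite /=; lra.
  have wy : whole_arc (val nu') \in tan_arcs (pl y).
    by rewrite plE; apply: (mem_tan_arc_pt (ell_gt0 ellP)).
  have nuE : val nu = whole_arc (val nu').
    apply: (germ_inj ellP (valP nu) wy).
    have [m [m0 md ml]] : exists m, [/\ 0 < m, m <= delta & m <= len (val nu').1 - arc_pos y (val nu')].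
      exists (Num.min delta (len (val nu').1 - arc_pos y (val nu'))).
      by rewrite lt_min !ge_min !lexx orbT d0; split=> //; lra.
    exists m => // h hm; have := dP h ltac:(lra); rewrite !advanceE => <-.
    rewrite place_arc_pt //; last by lra.
    by rewrite plE (arc_pos_arc_pt (ell_gt0 ellP)) // addrA.
  rewrite -point_slopeE nuE plE -[LHS]/(arc_slopes S _ _ i) /=.
  by rewrite slopes_on_piece.
- congr (@mrank _ _ _ _ S _ _); apply/ffunP => nu; rewrite ffunE.
  by apply: ab; apply: ((thetaP v).2 _ _).2.
case: x xv => -[v|[e t]] xP xv.
  case: (xv (inl v)); exact: val_inj.
have te := xP; rewrite /is_point in te.
have xE : Point xP = arc_pt ell (e, false) t by apply: val_inj; rewrite val_arc_pt.
rewrite xE; apply: (not_break_standard ellP hD MS) => // tb.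
have [k kn kE] := pbreak te tb.
by apply: (xv (path_vertex n e k)); rewrite place_vertex // ?kE // leqW.
Qed.

End AdmissibleStructure.

Theorem theorem1p4 (R : realType) (G : graph) (ell : edge G -> R)
  (hG : metric_graph ell) (D : divisor ell)
  (hD : forall x : mpoint ell, D x <> 0%R -> exists v : vertex G, x = vert ell v)
  (r : nat) :
  exists (k : nat) (n : 'I_k -> edge G -> nat)
    (SS : forall j : 'I_k, slope_structure r (subdivision (n j))),
  forall (M : set (mpoint ell -> R)) (S : slope_data r ell),
    admissible D M S ->
    exists (j : 'I_k) (p : edge G -> nat -> R),
      placement (n j) ell p /\
      defined_on (place (n := n j) ell p) (SS j) S.
Proof.
have [B BP] := RatD_slope_bounded hG hD.
(* room for all the breaks, and at least two points so that the subdivision is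
   simple *)
pose N := (r.+1 * B + r.+1 * B).+2.
have [k [SS SSP]] := finitely_many_bounded_structures r (subdivision (fun _ : edge G => N)) B.
exists k, (fun _ _ => N), SS => M S MS.
have [p [pP pbr]] := placement_through_breaks hG hD MS BP (leqnSn (r.+1 * B + r.+1 * B).+1).
have [s [sB sS]] := structure_on_subdivision hG hD MS BP (n := fun _ => N) (fun _ => isT) pP pbr.
by have [j jE] := SSP s sB; exists j, p; rewrite jE.
Qed.
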